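(* Fix $\epsilon\in(0,1)$. Let $\boldsymbol{y}_1,\dots,\boldsymbol{y}_M$ be arbitrary (non-random) points in the ball of radius $1-\epsilon$ centred at the origin in $\mathbb{R}^n$, and for each $i$ let $\boldsymbol{x}_i$ be chosen uniformly at random from the ball of radius $\epsilon$ centred at $\boldsymbol{y}_i$, independently for different $i$. Then for any $\frac{1}{\sqrt n}<\delta<1$, the set $\{\boldsymbol{x}_1,\dots,\boldsymbol{x}_M\}$ is Fisher-separable (with respect to the centres $\boldsymbol{y}_i$) with probability at least $$1-\frac{2M^2}{\delta\sqrt n}\left(\sqrt{1-\delta^2}\right)^{n+1}-M\left(\frac{2\delta}{\epsilon}\right)^n.$$ In particular, for every $v>0$ there are constants $a>0$, $b>1$ depending only on $v$ and $\epsilon$ such that the set is Fisher-separable (with respect to the centres $\boldsymbol{y}_i$) with probability at least $1-v$ whenever $M<ab^n$.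
   Context: Fisher separability with respect to the centres $\boldsymbol{y}_i$: for each $i$, Fisher's discriminant separating $\boldsymbol{x}_i$ is computed with coordinate origin at $\boldsymbol{y}_i$, i.e. the set is Fisher-separable if for all $i$ and all $j\neq i$, $(\boldsymbol{x}_i-\boldsymbol{y}_i,\boldsymbol{x}_i-\boldsymbol{y}_i)>(\boldsymbol{x}_i-\boldsymbol{y}_i,\boldsymbol{x}_j-\boldsymbol{y}_i)$, where $(\cdot,\cdot)$ is the Euclidean inner product. *)

(* Defs.v *)
From HB Require Import structures.
From mathcomp Require Import all_boot all_order all_algebra.
From mathcomp Require Import all_classical all_reals all_analysis.
Set Implicit Arguments. Unset Strict Implicit. Unset Printing Implicit Defensive.
Import Order.TTheory GRing.Theory Num.Theory.
Local Open Scope classical_set_scope.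
Local Open Scope ring_scope.

Definition dotv (R : realType) (n : nat) (u v : 'rV[R]_n) : R :=
  \sum_(j < n) u ord0 j * v ord0 j.

Definition normv (R : realType) (n : nat) (u : 'rV[R]_n) : R :=
  Num.sqrt (dotv u u).

Definition eball (R : realType) (n : nat) (c : 'rV[R]_n) (r : R) : set 'rV[R]_n :=
  [set x | normv (x - c) <= r].

(* n-dimensional Lebesgue measure on R^n, defined as the iterated
   (Tonelli) product of the one-dimensional Lebesgue measure:
   leb_0 is the unit mass on the single point of R^0, and
   leb_{n+1}(A) = \int leb_n (section of A at first coordinate x) dx. *)
Fixpoint lebn (R : realType) (n : nat) : set 'rV[R]_n -> \bar R :=
  match n with
  | 0 => fun A => if `[< A 0 >] then 1%E else 0%E
  | n'.+1 => fun A =>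
      (\int[@lebesgue_measure R]_x
         lebn [set v : 'rV[R]_n' | A (row_mx (\row_(j < 1) x) v)])%E
  end.

Definition fisher_separable (R : realType) (M n : nat) (X Y : 'M[R]_(M, n)) : Prop :=
  forall i j : 'I_M, i != j ->
    dotv (row i X - row i Y) (row j X - row i Y) <
    dotv (row i X - row i Y) (row i X - row i Y).

(* Configuration space: the M points (x_1,...,x_M) in R^n are encoded as one
   vector of R^(M*n) (the rows of the M x n matrix X, via mxvec/vec_mx).
   x_i independent and uniform on the ball B(y_i, eps) means the joint law
   is the normalized Lebesgue measure on the product of these balls. *)
Definition config_support (R : realType) (M n : nat) (Y : 'M[R]_(M, n)) (eps : R)
  : set 'rV[R]_(M * n) :=
  [set v | forall i : 'I_M, eball (row i Y) eps (row i (vec_mx v))].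

Definition prob_fisher_separable (R : realType) (M n : nat) (Y : 'M[R]_(M, n)) (eps : R)
  : R :=
  fine (lebn (config_support Y eps `&` [set v | fisher_separable (vec_mx v) Y]))
  / fine (lebn (config_support Y eps)).

(* Main.v *)
Require Import Defs.
From HB Require Import structures.
From mathcomp Require Import all_boot all_order all_algebra.
From mathcomp Require Import all_classical all_reals all_analysis.
From mathcomp Require Import measurable_realfun ring lra.
Import Order.TTheory GRing.Theory Num.Theory.
Import numFieldNormedType.Exports.
Local Open Scope classical_set_scope.
Local Open Scope ring_scope.

(* Write z = x_i - y_i and u = x_j - y_i, so that |u| <= 2. The pair (i, j)
   violates separability iff (z, u) >= |z|^2; unless |z| <= 2 delta, this puts z
   in the cone (z, u) >= delta |u| |z|. The first alternative has probability
   (2 delta / eps)^n by scaling, and a union bound over i and (i, j) concludes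
   once the cone is shown to occupy a fraction of the ball at most
   2 / (delta sqrt n) (1 - delta^2)^((n+1)/2). If 2 delta >= eps the claimed bound
   is nonpositive, so delta < 1/2 and n >= 5 may be assumed.

   The cone estimate does not use rotation invariance. Slicing along hyperplanes
   orthogonal to u, in the coordinates (s, x') with s = (z, u/|u|) and x' all
   coordinates but the first, every slice of a ball is a translate of a dilate of
   one fixed ellipsoid of R^(n-1), whose volume cancels in the quotient. These
   coordinates need u_0 <> 0, which holds for almost every x_j. *)

Set Implicit Arguments.
Unset Strict Implicit.
Unset Printing Implicit Defensive.

(** * Lebesgue measure on row vectors *)

Section measurable_rV.
Context {R : realType} (n : nat).

Let coor (i : 'I_n) (v : 'rV[R]_n) : R := v ord0 i.

Let rV_set0 : g_sigma_preimage coor set0.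
Proof. exact: sigma_algebra0. Qed.

Let rV_setC A : g_sigma_preimage coor A -> g_sigma_preimage coor (~` A).
Proof. exact: sigma_algebraC. Qed.

Let rV_bigcup (F : (set 'rV[R]_n)^nat) :
  (forall i, g_sigma_preimage coor (F i)) ->
  g_sigma_preimage coor (\bigcup_i F i).
Proof. exact: sigma_algebra_bigcup. Qed.

(** The sigma-algebra is the one generated by the coordinates, so that measurability of a map into
    row vectors can be checked coordinatewise. *)
HB.instance Definition _ := @isMeasurable.Build
  (measure_tuple_display default_measure_display)
  'rV[R]_n (g_sigma_preimage coor) rV_set0 rV_setC rV_bigcup.

Lemma measurable_coord (i : 'I_n) :
  measurable_fun [set: 'rV[R]_n] (fun v : 'rV[R]_n => v ord0 i : R).
Proof.
move=> _ Y mY; rewrite setTI; apply: sub_sigma_algebra => /=.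
rewrite -bigcup_seq/=; exists i => /=; first by rewrite mem_index_enum.
by exists Y => //; rewrite setTI.
Qed.

Lemma measurable_fun_rV d (T : measurableType d) (f : T -> 'rV[R]_n) :
  (forall i, measurable_fun [set: T] (fun x => f x ord0 i : R)) ->
  measurable_fun [set: T] f.
Proof.
move=> mf; pose G := \big[setU/set0]_(i < n) preimage_set_system setT (coor i) measurable.
apply: (measurability G) => // A [B GB <-{A}].
move: GB; rewrite /G -bigcup_seq => -[i] _ [Y mY <-].
by have := mf i measurableT Y mY; rewrite !setTI.
Qed.

End measurable_rV.

Section lebn_measure.
Context {R : realType}.
Local Open Scope ereal_scope.

(** Built from the same [row_mx] as the recursion of [lebn], so that [lebn] in dimension n+1 is, by
    conversion, an integral over sections along [consv]. *)
Definition consv n (p : measurableTypeR R * 'rV[R]_n) : 'rV[R]_n.+1 :=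
  row_mx (\row_(j < 1) p.1) p.2.

Lemma consv0 n p : consv (n := n) p ord0 ord0 = p.1.
Proof.
rewrite /consv mxE; case: split_ordP => j; first by rewrite mxE.
by move=> /(congr1 val).
Qed.

Lemma consvS n p (i : 'I_n) : consv (n := n) p ord0 (lift ord0 i) = p.2 ord0 i.
Proof.
rewrite /consv mxE; case: split_ordP => j /(congr1 val)/=.
  by rewrite ord1.
by rewrite /bump/= !add1n => -[/val_inj <-].
Qed.

Lemma measurable_consv n : measurable_fun setT (@consv n).
Proof.
apply: measurable_fun_rV => i; case: (unliftP ord0 i) => [j|] ->.
  under eq_fun do rewrite consvS.
  apply: (@measurableT_comp _ _ _ _ _ _ (fun v : 'rV[R]_n => v ord0 j) _ snd) => //.
  exact: measurable_coord.
under eq_fun do rewrite consv0.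
exact: measurable_fst.
Qed.

Definition unconsv n (v : 'rV[R]_n.+1) : measurableTypeR R * 'rV[R]_n :=
  (v ord0 ord0, \row_i v ord0 (lift ord0 i)).

Lemma consvK n : cancel (@consv n) (@unconsv n).
Proof.
move=> [x v]; rewrite /unconsv consv0; congr pair.
by apply/rowP => i; rewrite mxE consvS.
Qed.

Lemma measurable_unconsv n : measurable_fun setT (@unconsv n).
Proof.
apply: measurable_fun_pair => /=; first exact: measurable_coord.
apply: measurable_fun_rV => i; under eq_fun do rewrite mxE.
exact: measurable_coord.
Qed.

(** Stated for [lebn] as a bare set function: the induction that makes it a measure rests on this
    description as the image of a product. *)
Lemma lebnS n (A : set 'rV[R]_n.+1) :
  lebn A = pushforward (@lebesgue_measure R \x @lebn R n) (@consv n) A.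
Proof.
rewrite /pushforward /product_measure1 /=; apply: eq_integral => x _ /=.
congr lebn; apply/seteqP; split => v /=; rewrite /xsection/= inE.
- by [].
- by [].
Qed.

(** The four properties go through the induction together, because the product measure behind
    dimension n+1 is taken with a sigma-finite second factor. *)
Let lebn_is_measure n : [/\ @lebn R n set0 = 0, (forall A, 0 <= @lebn R n A),
  semi_sigma_additive (@lebn R n) & sigma_finite setT (@lebn R n)].
Proof.
elim: n => [|n [n0 n_ge0 n_add n_fin]].
  have -> : @lebn R 0 = @dirac _ 'rV[R]_0 0%R R.
    apply/funext => A; rewrite /dirac indicE /lebn; case: asboolP => A0.
      by rewrite mem_set.
    by rewrite memNset.
  split => //; [exact: measure_semi_sigma_additive|exact: sigma_finiteT].
(* Bundling the induction hypothesis into [mu] gives access to the theory of product measures. *)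
have [mu muE] : exists mu : {sigma_finite_measure set 'rV[R]_n -> \bar R},
    @lebn R n = mu.
  pose m1 := isMeasure.Build _ _ _ (@lebn R n) n0 n_ge0 n_add.
  pose mu1 : {measure set 'rV[R]_n -> \bar R} := HB.pack (@lebn R n) m1.
  pose m2 := Measure_isSigmaFinite.Build _ _ _ mu1 n_fin.
  pose mu : {sigma_finite_measure set 'rV[R]_n -> \bar R} :=
    HB.pack (@lebn R n) m1 m2.
  by exists mu.
have -> : @lebn R n.+1 = pushforward (@lebesgue_measure R \x mu) (@consv n).
  by apply/funext => A; rewrite lebnS muE.
have mc := @measurable_consv n.
split.
- by rewrite /pushforward preimage_set0 measure0.
- by move=> A; exact: measure_ge0.
- exact: (@measure_semi_sigma_additive _ _ _
    (measure_function_pushforward__canonical__measure_function_Measure _ mc)).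
- have /sigma_finiteP[F [TF ndF Foo]] := sigma_finiteT (@lebesgue_measure R).
  have /sigma_finiteP[G [TG ndG Goo]] := sigma_finiteT mu.
  (* Products of the two exhaustions, transported by [unconsv]. Both are nondecreasing, so a point
     may use the larger of its two indices. *)
  exists (fun k => @unconsv n @^-1` (F k `*` G k)).
    rewrite -preimage_bigcup -(preimage_setT (@unconsv n)); congr preimage.
    rewrite -setXTT TF TG; apply/seteqP; split => -[x y].
      move=> [/= [k _ Fkx] [l _ Gly]]; exists (maxn k l) => //; split.
      - by move: x Fkx; exact/subsetPset/ndF/leq_maxl.
      - by move: y Gly; exact/subsetPset/ndG/leq_maxr.
    by move=> [k _ [/= ? ?]]; split; exists k.
  move=> k; have [mF Fk] := Foo k; have [mG Gk] := Goo k; split.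
    rewrite -[X in measurable X]setTI; apply: measurable_unconsv => //.
    exact: measurableX.
  rewrite /pushforward -comp_preimage (_ : _ \o _ = id); last first.
    by apply/funext => p; exact: consvK.
  by rewrite product_measure1E// lte_mul_pinfty// ge0_fin_numE.
Qed.

HB.instance Definition _ n := let: And4 n0 n_ge0 n_add _ := lebn_is_measure n in
  isMeasure.Build _ _ _ (@lebn R n) n0 n_ge0 n_add.

HB.instance Definition _ n := let: And4 _ _ _ n_fin := lebn_is_measure n in
  Measure_isSigmaFinite.Build _ _ _ (@lebn R n) n_fin.

End lebn_measure.

(** * Affine changes of variable on the line *)

Section lebesgue_affine.
Context {R : realType}.
Local Open Scope ereal_scope.
Local Notation leb := (@lebesgue_measure R).

Lemma measurable_affine (a b : R) :
  measurable_fun setT ((fun x => a * x + b)%R : measurableTypeR R -> measurableTypeR R).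
Proof. by apply: measurable_funD => //; exact: measurable_funM. Qed.

(** The scaled image measure [nu] agrees with Lebesgue measure on the intervals ]x, y], hence
    everywhere by uniqueness. *)
Lemma lebesgue_measure_affine (a b : R) (A : set (measurableTypeR R)) :
  a != 0%R -> measurable A -> leb A = `|a|%:E * leb [set x | A (a * x + b)%R].
Proof.
move=> a0 mA.
pose f : measurableTypeR R -> measurableTypeR R := (fun x => a * x + b)%R.
have mf : measurable_fun setT f := measurable_affine a b.
pose nu := mscale (NngNum (normr_ge0 a))
  (measure_function_pushforward__canonical__measure_function_Measure leb mf).
rewrite (@lebesgue_measure_unique _ nu)//.
move=> _ [[x y]] _ <-; rewrite /= /mscale/= /pushforward.
have [xy|yx] := ltP x y; last first.
  rewrite (_ : `]x, y]%classic = set0); last first.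
    by apply/seteqP; split => z //=; rewrite in_itv/= => /andP[? ?]; lra.
  by rewrite preimage_set0 !measure0 mule0.
have [an|ap|/eqP] := ltgtP a 0%R; last by rewrite (negPf a0).
(* A negative slope exchanges the open and the closed end of the interval. *)
- rewrite (_ : _ @^-1` _ = `[((y - b) / a)%R, ((x - b) / a)%R[%classic); last first.
    apply/seteqP; split => z /=; rewrite !in_itv/= /f ler_ndivrMr// ltr_ndivlMr//.
      by move=> /andP[? ?]; apply/andP; split; lra.
    by move=> /andP[? ?]; apply/andP; split; lra.
  rewrite !lebesgue_measure_itv/= !lte_fin xy ltr_ndivlMr//.
  rewrite mulfVK// ?lt_eqF// ltrD2r xy -!EFinB -EFinM ltr0_norm//.
  by congr EFin; field.
- rewrite (_ : _ @^-1` _ = `]((x - b) / a)%R, ((y - b) / a)%R]%classic); last first.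
    apply/seteqP; split => z /=; rewrite !in_itv/= /f ltr_pdivrMr// ler_pdivlMr//.
      by move=> /andP[? ?]; apply/andP; split; lra.
    by move=> /andP[? ?]; apply/andP; split; lra.
  rewrite !lebesgue_measure_itv/= !lte_fin xy ltr_pdivlMr//.
  rewrite mulfVK// ?gt_eqF// ltrD2r xy -!EFinB -EFinM gtr0_norm//.
  by congr EFin; field.
Qed.

Lemma ge0_integral_affine (a b : R) (f : R -> \bar R) : a != 0%R ->
  measurable_fun setT f -> (forall x, 0 <= f x) ->
  \int[leb]_x f x = `|a|%:E * \int[leb]_x f (a * x + b)%R.
Proof.
move=> a0 mf f0.
pose g : measurableTypeR R -> measurableTypeR R := (fun x => a * x + b)%R.
have mg : measurable_fun setT g := measurable_affine a b.
pose pf := measure_function_pushforward__canonical__measure_function_Measure leb mg.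
have -> : \int[leb]_x f (a * x + b)%R = \int[pf]_x f x.
  by rewrite (ge0_integral_pushforward mg).
rewrite -(ge0_integral_mscale pf measurableT (NngNum (normr_ge0 a)))//.
by apply: eq_measure_integral => A mA _; exact: lebesgue_measure_affine.
Qed.

End lebesgue_affine.

(** * Tonelli's theorem for blocks of coordinates *)

Section lebn_fubini.
Context {R : realType}.
Local Open Scope ereal_scope.
Local Notation leb := (@lebesgue_measure R).

Lemma ge0_integral_lebnS n (f : 'rV[R]_n.+1 -> \bar R) :
  measurable_fun setT f -> (forall v, 0 <= f v) ->
  \int[@lebn R n.+1]_v f v = \int[leb]_x \int[@lebn R n]_v f (consv (x, v)).
Proof.
move=> mf f0; have mc := @measurable_consv R n.
pose pf := measure_function_pushforward__canonical__measure_function_Measure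
  (leb \x @lebn R n) mc.
transitivity (\int[pf]_v f v).
  by apply: eq_measure_integral => A mA _; exact: lebnS.
rewrite (ge0_integral_pushforward mc)//= preimage_setT.
by rewrite fubini_tonelli1//; exact: measurableT_comp.
Qed.

Definition catv a b (p : 'rV[R]_a * 'rV[R]_b) : 'rV[R]_(a + b) := row_mx p.1 p.2.

Lemma measurable_catv a b : measurable_fun setT (@catv a b).
Proof.
apply: measurable_fun_rV => i; rewrite /catv; case: (split_ordP i) => j ->.
  under eq_fun do rewrite row_mxEl.
  apply: (@measurableT_comp _ _ _ _ _ _ (fun v : 'rV[R]_a => v ord0 j) _ fst) => //.
  exact: measurable_coord.
under eq_fun do rewrite row_mxEr.
apply: (@measurableT_comp _ _ _ _ _ _ (fun v : 'rV[R]_b => v ord0 j) _ snd) => //.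
exact: measurable_coord.
Qed.

Lemma xsection_preimage d d' (T : measurableType d) (T' : measurableType d') U
    (f : T * T' -> U) (A : set U) x :
  xsection (f @^-1` A) x = [set y | A (f (x, y))].
Proof. by apply/seteqP; split => y; rewrite /xsection/= inE. Qed.

Lemma measurable_lebn_section a b (A : set 'rV[R]_(a + b)) : measurable A ->
  measurable_fun setT (fun x : 'rV[R]_a => @lebn R b [set y | A (row_mx x y)]).
Proof.
move=> mA; rewrite (_ : (fun x => _) = @lebn R b \o xsection (@catv a b @^-1` A)).
  apply: measurable_fun_xsection.
  by rewrite -[X in measurable X]setTI; exact: measurable_catv.
by apply/funext => x /=; rewrite xsection_preimage.
Qed.

Lemma measurable_cons_section n (A : set 'rV[R]_n.+1) x : measurable A ->
  measurable [set v | A (consv (x, v))].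
Proof.
move=> mA; rewrite -(xsection_preimage (@consv R n)).
apply: measurable_xsection.
by rewrite -[X in measurable X]setTI; exact: measurable_consv.
Qed.

(** The recursion of [lebn] splits off one coordinate; iterating it splits off a block, which later
    isolates one point of a configuration. *)
Lemma lebn_cat a b (A : set 'rV[R]_(a + b)) : measurable A ->
  lebn A = \int[@lebn R a]_x @lebn R b [set y | A (row_mx x y)].
Proof.
elim: a => [|a IHa] in A * => mA.
  rewrite (_ : \int[@lebn R 0]_x _ =
      \int[@dirac _ 'rV[R]_0 0%R R]_x @lebn R b [set y | A (row_mx x y)]).
    rewrite integral_dirac//; last exact: measurable_lebn_section.
    rewrite diracT mul1e; congr lebn.
    by apply/seteqP; split => v /=; rewrite row_thin_mx.
  apply: eq_measure_integral => /= B mB _; rewrite /dirac indicE.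
  by case: asboolP => B0; [rewrite mem_set|rewrite memNset].
rewrite ge0_integral_lebnS//; last exact: measurable_lebn_section.
rewrite (@lebnS R (a + b) A); apply: eq_integral => x _.
rewrite [LHS]/= xsection_preimage IHa; last exact: measurable_cons_section.
apply: eq_integral => s _; congr lebn; apply/seteqP.
(* The two dimensions are convertible, so associativity of [row_mx] leaves only a trivial cast. *)
have rA y : consv (x, row_mx s y) = row_mx (consv (x, s)) y :> 'rV[R]_(a.+1 + b).
  by rewrite /consv row_mxA castmx_id.
by split => y /=; rewrite rA.
Qed.

End lebn_fubini.

Section measurable_euclidean.
Context {R : realType} d {T : measurableType d}.

Lemma measurable_set_ler (f g : T -> R) :
  measurable_fun setT f -> measurable_fun setT g ->
  measurable [set x | f x <= g x].
Proof.
move=> mf mg; rewrite -[X in measurable X]setTI.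
by apply: (measurable_fun_ler mf mg measurableT (Y := [set true])).
Qed.

Lemma measurable_set_ltr (f g : T -> R) :
  measurable_fun setT f -> measurable_fun setT g ->
  measurable [set x | f x < g x].
Proof.
move=> mf mg; rewrite -[X in measurable X]setTI.
by apply: (measurable_fun_ltr mf mg measurableT (Y := [set true])).
Qed.

Lemma measurable_coord_comp n (f : T -> 'rV[R]_n) (i : 'I_n) :
  measurable_fun setT f -> measurable_fun setT (fun t => f t ord0 i).
Proof.
move=> mf; apply: (@measurableT_comp _ _ _ _ _ _ (fun v : 'rV[R]_n => v ord0 i : R)) => //.
exact: measurable_coord.
Qed.

Lemma measurable_dotv n (f g : T -> 'rV[R]_n) :
  measurable_fun setT f -> measurable_fun setT g ->
  measurable_fun setT (fun t => dotv (f t) (g t)).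
Proof.
move=> mf mg; apply: measurable_sum => i.
by apply: measurable_funM; exact: measurable_coord_comp.
Qed.

Lemma measurable_addv n (f g : T -> 'rV[R]_n) :
  measurable_fun setT f -> measurable_fun setT g ->
  measurable_fun setT (fun t => f t + g t).
Proof.
move=> mf mg; apply: measurable_fun_rV => i; under eq_fun do rewrite mxE.
by apply: measurable_funD; exact: measurable_coord_comp.
Qed.

Lemma measurable_scalev n (r : R) (f : T -> 'rV[R]_n) :
  measurable_fun setT f -> measurable_fun setT (fun t => r *: f t).
Proof.
move=> mf; apply: measurable_fun_rV => i; under eq_fun do rewrite mxE.
by apply: measurable_funM => //; exact: measurable_coord_comp.
Qed.

Lemma measurable_normv n (f : T -> 'rV[R]_n) :
  measurable_fun setT f -> measurable_fun setT (fun t => normv (f t)).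
Proof.
move=> mf; rewrite /normv.
apply: (@measurableT_comp _ _ _ _ _ _ (@Num.sqrt R)); last exact: measurable_dotv.
by apply: continuous_measurable_fun; exact: sqrt_continuous.
Qed.

End measurable_euclidean.

(** * Dilations, translations and oblique coordinates *)

Section lebn_change_of_variables.
Context {R : realType}.
Local Open Scope ereal_scope.
Local Notation leb := (@lebesgue_measure R).

Lemma lebn_consE n (A : set 'rV[R]_n.+1) :
  lebn A = \int[leb]_x @lebn R n [set v | A (consv (x, v))].
Proof. by []. Qed.

Lemma measurable_lebn_cons n (A : set 'rV[R]_n.+1) : measurable A ->
  measurable_fun setT
    (fun x : measurableTypeR R => @lebn R n [set v | A (consv (x, v))]).
Proof.
move=> mA; rewrite (_ : (fun x => _) = @lebn R n \o xsection (@consv R n @^-1` A)).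
  apply: measurable_fun_xsection.
  by rewrite -[X in measurable X]setTI; exact: measurable_consv.
by apply/funext => x /=; rewrite xsection_preimage.
Qed.

Lemma consv_affine n (r : R) (c : 'rV[R]_n.+1) x v :
  (r *: consv (x, v) + c =
   consv ((r * x + c ord0 ord0), (r *: v + (unconsv c).2)))%R.
Proof.
have E k (M N : 'rV[R]_k) i : ((r *: M + N) ord0 i = r * M ord0 i + N ord0 i)%R.
  by rewrite !mxE.
apply/rowP => i; rewrite E.
by case: (unliftP ord0 i) => [j|] ->; rewrite ?consvS ?consv0//= E mxE.
Qed.

Lemma measurable_preimage_affine n (r : R) (c : 'rV[R]_n) (A : set 'rV[R]_n) :
  measurable A -> measurable [set v | A (r *: v + c)%R].
Proof.
move=> mA; rewrite -[X in measurable X]setTI.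
have mf : measurable_fun setT (fun v : 'rV[R]_n => r *: v + c)%R.
  by apply: measurable_addv => //; exact: measurable_scalev.
exact: mf.
Qed.

(** The first coordinate contributes a factor [r] by the one-dimensional case, the others by
    induction applied to the tail of [c]. *)
Lemma lebn_affine n (r : R) (c : 'rV[R]_n) (A : set 'rV[R]_n) : (0 < r)%R ->
  measurable A -> lebn A = (r ^+ n)%:E * lebn [set v | A (r *: v + c)%R].
Proof.
move=> r0; elim: n => [|n IHn] in c A * => mA.
  rewrite expr0 mul1e; congr lebn; apply/seteqP; split => v /=;
  by rewrite [X in A X -> _]thinmx0 [X in _ -> A X]thinmx0.
rewrite lebn_consE (@ge0_integral_affine _ r (c ord0 ord0)) ?gt_eqF//; last first.
  exact: measurable_lebn_cons.
rewrite (gtr0_norm r0) exprS EFinM -muleA; congr (_ * _).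
rewrite lebn_consE -ge0_integralZl//; last 2 first.
- apply: measurable_lebn_cons.
  exact: measurable_preimage_affine.
- by rewrite lee_fin exprn_ge0// ltW.
apply: eq_integral => x _; rewrite (IHn (unconsv c).2); last first.
  exact: measurable_cons_section.
by congr (_ * lebn _); apply/seteqP; split => v /=; rewrite consv_affine.
Qed.

(** Both iterated integrals take the product value on rectangles, and the product measure is
    unique. *)
Lemma product_measure_swap d1 d2 (T1 : measurableType d1) (T2 : measurableType d2)
    (m1 : {sigma_finite_measure set T1 -> \bar R})
    (m2 : {sigma_finite_measure set T2 -> \bar R}) (A : set (T1 * T2)) :
  measurable A ->
  \int[m1]_x m2 (xsection A x) = \int[m2]_y m1 (ysection A y).
Proof.
move=> mA; transitivity ((m1 \x m2) A) => //.
transitivity ((m1 \x^ m2) A) => //.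
by apply: product_measure_unique => // *; exact: product_measure2E.
Qed.

(** For z = (z_0, x) and u = (a, w), the height s = (z, u) equals a z_0 + (x, w). Hence z_0 = (s -
    (x, w)) / a, and (s, x) serve as coordinates. *)
Lemma measurable_oblique m (a : R) (w : 'rV[R]_m) (A : set 'rV[R]_m.+1) :
  measurable A ->
  measurable [set p : measurableTypeR R * 'rV[R]_m |
    A (consv ((p.1 - dotv p.2 w) / a, p.2)%R)].
Proof.
move=> mA; pose g (p : measurableTypeR R * 'rV[R]_m) : 'rV[R]_m.+1 :=
  consv ((p.1 - dotv p.2 w) / a, p.2)%R.
have mg : measurable_fun setT g.
  apply: (measurableT_comp (@measurable_consv R m)).
  apply: measurable_fun_pair => //=.
  apply: measurable_funM => //; apply: measurable_funB => //.
  exact: measurable_dotv.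
by rewrite -[X in measurable X]setTI; exact: mg.
Qed.

Lemma measurable_lebn_oblique m (a : R) (w : 'rV[R]_m) (A : set 'rV[R]_m.+1) :
  measurable A ->
  measurable_fun setT (fun s : measurableTypeR R => @lebn R m
             [set x | A (consv ((s - dotv x w) / a, x))%R]).
Proof.
move=> mA; have := measurable_fun_xsection (@lebn R m) (measurable_oblique a w mA).
congr measurable_fun; apply/funext => s /=; congr lebn.
by apply/seteqP; split => x; rewrite /xsection/= inE.
Qed.

(** For fixed [x], z_0 is an affine function of s with slope 1/a. Exchanging the order of
    integration before and after this one-dimensional change of variable gives the formula. *)
Lemma lebn_oblique m (a : R) (w : 'rV[R]_m) (A : set 'rV[R]_m.+1) :
  a != 0%R -> measurable A ->
  lebn A = `|a^-1|%:E * \int[leb]_s @lebn R m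
             [set x | A (consv ((s - dotv x w) / a, x))%R].
Proof.
move=> a0 mA.
pose g (p : measurableTypeR R * 'rV[R]_m) : 'rV[R]_m.+1 :=
  consv ((p.1 - dotv p.2 w) / a, p.2)%R.
have mgA : measurable (g @^-1` A) := measurable_oblique a w mA.
have mcA : measurable (@consv R m @^-1` A).
  by rewrite -[X in measurable X]setTI; exact: measurable_consv.
have -> : \int[leb]_s @lebn R m [set x | A (consv ((s - dotv x w) / a, x))%R] =
    \int[@lebn R m]_x leb (ysection (g @^-1` A) x).
  rewrite -product_measure_swap//.
  by apply: eq_integral => s _; rewrite xsection_preimage.
transitivity (\int[@lebn R m]_x leb (ysection (@consv R m @^-1` A) x)).
  rewrite -product_measure_swap// lebn_consE.
  by apply: eq_integral => s _; rewrite xsection_preimage.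
rewrite -ge0_integralZl//; last exact: measurable_fun_ysection.
apply: eq_integral => x _.
rewrite (@lebesgue_measure_affine _ a^-1 (- (dotv x w / a)))%R ?invr_eq0//; last first.
  exact: measurable_ysection.
congr (_ * leb _); apply/seteqP; split => s; rewrite /ysection/= !inE /g/=;
by rewrite mulrBl [(s / a)%R]mulrC.
Qed.

End lebn_change_of_variables.

(** * Oblique slices of the ball and of a cone *)

Section dot_product.
Context {R : realType} {n : nat}.
Implicit Types (u v w : 'rV[R]_n) (r : R).

Lemma dotvC u v : dotv u v = dotv v u.
Proof. by apply: eq_bigr => i _; rewrite mulrC. Qed.

Lemma dotvDl u v w : dotv (u + v) w = dotv u w + dotv v w.
Proof. by rewrite -big_split; apply: eq_bigr => i _; rewrite mxE mulrDl. Qed.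

Lemma dotvDr u v w : dotv u (v + w) = dotv u v + dotv u w.
Proof. by rewrite dotvC dotvDl !(dotvC u). Qed.

Lemma dotvZl r u v : dotv (r *: u) v = r * dotv u v.
Proof. by rewrite /dotv mulr_sumr; apply: eq_bigr => i _; rewrite mxE mulrA. Qed.

Lemma dotvZr r u v : dotv u (r *: v) = r * dotv u v.
Proof. by rewrite dotvC dotvZl dotvC. Qed.

Lemma dotvv_ge0 u : 0 <= dotv u u.
Proof. by apply: sumr_ge0 => i _; rewrite -expr2 sqr_ge0. Qed.

Lemma normv_ge0 u : 0 <= normv u.
Proof. exact: sqrtr_ge0. Qed.

Lemma sqr_normv u : normv u ^+ 2 = dotv u u.
Proof. by rewrite sqr_sqrtr// dotvv_ge0. Qed.

Lemma normvZ r u : normv (r *: u) = `|r| * normv u.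
Proof. by rewrite /normv dotvZl dotvZr mulrA -expr2 sqrtrM ?sqr_ge0// sqrtr_sqr. Qed.

Lemma normv_le r u : 0 <= r -> (normv u <= r) = (dotv u u <= r ^+ 2).
Proof. by move=> r0; rewrite -sqr_normv ler_pXn2r// nnegrE ?normv_ge0. Qed.

End dot_product.

(** Serves to bound (1 - s^2)^m from below, the square of the relative volume of a ball slice near
    the centre. *)
Lemma bernoulli {R : realType} k (x : R) : 0 <= x <= 1 ->
  1 - k%:R * x <= (1 - x) ^+ k.
Proof.
move=> /andP[x0 x1]; elim: k => [|k IHk]; first by rewrite mul0r subr0 expr0.
rewrite exprS -natr1; have k0 : 0 <= k%:R :> R by [].
have : (1 - x) * (1 - k%:R * x) <= (1 - x) * (1 - x) ^+ k.
  by rewrite ler_wpM2l// subr_ge0.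
have : 0 <= k%:R * (x * x) by rewrite !mulr_ge0.
by lra.
Qed.

Lemma dotv_consv {R : realType} n (x y : R) (v w : 'rV[R]_n) :
  dotv (consv (x, v)) (consv (y, w)) = x * y + dotv v w.
Proof.
rewrite /dotv big_ord_recl !consv0; congr (_ + _).
by apply: eq_bigr => i _; rewrite !consvS.
Qed.

Lemma measurable_eball {R : realType} n (c : 'rV[R]_n) (r : R) :
  measurable (eball c r).
Proof.
have -> : eball c r = [set x | normv (x - c) <= r] by [].
apply: measurable_set_ler => //; by apply: measurable_normv; exact: measurable_addv.
Qed.

Section oblique_slices.
Context {R : realType} (m : nat) (a : R) (w : 'rV[R]_m).
Hypothesis a_neq0 : a != 0.
Hypothesis aw_unit : a ^+ 2 + dotv w w = 1.
Local Notation leb := (@lebesgue_measure R).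

(* The squared norm of the component of z orthogonal to the unit vector (a, w),
   as a function of the last m coordinates y of that component. *)
Definition slice_form (y : 'rV[R]_m) : R := dotv y y + (dotv y w / a) ^+ 2.

Lemma slice_formZ r y : slice_form (r *: y) = r ^+ 2 * slice_form y.
Proof. by rewrite /slice_form !dotvZl dotvZr; field. Qed.

Lemma measurable_slice_form (c : 'rV[R]_m) r :
  measurable [set x | slice_form (x - c) <= r].
Proof.
apply: measurable_set_ler => //.
have mB : measurable_fun setT (fun x : 'rV[R]_m => x - c) by exact: measurable_addv.
apply: measurable_funD; first exact: measurable_dotv.
apply: measurable_funX; apply: measurable_funM => //; exact: measurable_dotv.
Qed.

(** Never evaluated: it is a common factor of the lower bound for the ball and of the upper bound
    for the cone. *)
Definition slice_volume : \bar R := lebn [set x | slice_form x <= 1].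

Lemma slice_volume_ge0 : (0 <= slice_volume)%E.
Proof. exact: measure_ge0. Qed.

Lemma lebn_slice_form (c : 'rV[R]_m) (r : R) : 0 < r ->
  lebn [set x | slice_form (x - c) <= r ^+ 2] = ((r ^+ m)%:E * slice_volume)%E.
Proof.
move=> r0; rewrite (@lebn_affine _ _ r c)//; last exact: measurable_slice_form.
congr (_ * lebn _)%E; apply/seteqP; split => x /=;
  by rewrite addrK slice_formZ ger_pMr// exprn_gt0.
Qed.

(** Pythagoras: with y = x - s w, the vector z - s (a, w) is orthogonal to the unit vector (a, w);
    its last coordinates are y and its first one is - (y, w) / a. *)
Lemma dotvv_slice (s : R) (x : 'rV[R]_m) :
  let z := consv ((s - dotv x w) / a, x) in
  dotv z z = s ^+ 2 + slice_form (x - s *: w).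
Proof.
rewrite /= dotv_consv /slice_form.
move: (x - s *: w) (subrK (s *: w) x) => y <-{x}.
rewrite !(dotvDl, dotvDr, dotvZl, dotvZr) (dotvC w y).
have -> : dotv w w = 1 - a ^+ 2 by rewrite -aw_unit addrC addKr.
by field.
Qed.

Lemma dotv_slice (s : R) (x : 'rV[R]_m) :
  dotv (consv ((s - dotv x w) / a, x)) (consv (a, w)) = s.
Proof. by rewrite dotv_consv divfK// subrK. Qed.

(** Only the slab |s| <= [t] is kept. Its width is 1 / sqrt (m+1), and each of its slices has volume
    at least 5/6 of [slice_volume]. *)
Lemma lebn_unit_ball_ge :
  ((`|a^-1| * (5 / 6 / Num.sqrt m.+1%:R))%:E * slice_volume <=
   lebn [set z : 'rV[R]_m.+1 | (dotv z z <= 1)%R])%E.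
Proof.
have mB : measurable [set z : 'rV[R]_m.+1 | dotv z z <= 1].
  by apply: measurable_set_ler => //; exact: measurable_dotv.
rewrite (@lebn_oblique _ _ a w)// EFinM -muleA.
apply: lee_wpmul2l; first by rewrite lee_fin.
have sm0 : 0 < Num.sqrt m.+1%:R :> R by rewrite sqrtr_gt0 ltr0n.
(* Chosen so that m s^2 <= 1/4 throughout the slab. *)
pose t := (2 * Num.sqrt m.+1%:R)^-1 : R.
have t0 : 0 < t by rewrite invr_gt0 mulr_gt0.
have t2 : t ^+ 2 = (4 * m.+1%:R)^-1.
  by rewrite exprVn exprMn sqr_sqrtr// -natrX.
pose D : set (measurableTypeR R) := `[- t, t]%classic.
have mD : measurable D by exact: measurable_itv.
have -> : ((5 / 6 / Num.sqrt m.+1%:R)%:E * slice_volume =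
    \int[leb]_(s in D) ((5 / 6)%:E * slice_volume))%E.
  rewrite integral_cst//=.
  have -> : leb D = (2 * t)%:E.
    rewrite /D lebesgue_measure_itv/= lte_fin (_ : (- t < t)%R); last by lra.
    by rewrite -EFinB; congr EFin; ring.
  rewrite [RHS]muleAC -EFinM; congr (_%:E * _)%E.
  by rewrite /t; field; rewrite gt_eqF.
pose F s : \bar R := @lebn R m
  [set x | dotv (consv ((s - dotv x w) / a, x)) (consv ((s - dotv x w) / a, x)) <= 1].
have mF : measurable_fun (setT : set (measurableTypeR R)) F.
  exact: (measurable_lebn_oblique a w mB).
apply: (@le_trans _ _ (\int[leb]_(s in D) F s)%E); last first.
  by apply: ge0_subset_integral.
apply: ge0_le_integral => //.
- by move=> s _; rewrite mule_ge0 ?slice_volume_ge0// lee_fin; lra.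
- exact: measurable_funTS.
move=> s; rewrite /D /= in_itv/= => /andP[s1 s2].
have s2t : s ^+ 2 <= (4 * m.+1%:R)^-1.
  by rewrite -t2; nra.
have mt : (4 * m.+1%:R)^-1 <= 1 / 4 :> R.
  by rewrite invfM div1r ler_piMr// ?invr_ge0// invf_le1// ?ltr0n// ler1n.
have s14 := le_trans s2t mt.
have q0 : 0 < 1 - s ^+ 2 by clear s2t mt; lra.
rewrite /F (_ : mkset _ =
    [set x | slice_form (x - s *: w) <= Num.sqrt (1 - s ^+ 2) ^+ 2]); last first.
  rewrite sqr_sqrtr; last exact: ltW.
  by apply/seteqP; split => x /=; rewrite dotvv_slice lerBrDl.
rewrite lebn_slice_form ?sqrtr_gt0//.
apply: lee_wpmul2r; first exact: slice_volume_ge0.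
rewrite lee_fin.
(* After squaring, Bernoulli gives (1 - s^2)^m >= 3/4, which exceeds (5/6)^2 = 25/36. *)
rewrite -(@ler_pXn2r _ 2)// ?nnegrE ?exprn_ge0 ?sqrtr_ge0//.
rewrite -exprM mulnC exprM sqr_sqrtr; last exact: ltW.
apply: le_trans (bernoulli m _); last by apply/andP; split; [exact: sqr_ge0|lra].
have : m%:R * s ^+ 2 <= 1 / 4.
  apply: (@le_trans _ _ (m.+1%:R * (4 * m.+1%:R)^-1)).
    by rewrite ler_pM// ?sqr_ge0// ler_nat.
  by rewrite invfM mulrCA divff ?mulr1 ?div1r// pnatr_eq0.
by lra.
Qed.

End oblique_slices.

(** * Upper bound for the volume of the cone *)

Section cone_volume.
Context {R : realType} (m : nat) (a : R) (w : 'rV[R]_m) (delta : R).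
Hypothesis m_gt0 : (0 < m)%N.
Hypothesis a_neq0 : a != 0.
Hypothesis aw_unit : a ^+ 2 + dotv w w = 1.
Hypothesis delta_gt0 : 0 < delta.
Hypothesis delta_lt1 : delta < 1.
Local Notation leb := (@lebesgue_measure R).
Local Notation q := (Num.sqrt (1 - delta ^+ 2)).
Local Notation kappa := (slice_volume a w).

Definition cone : set 'rV[R]_m.+1 :=
  [set z | dotv z z <= 1 /\ delta * normv z <= dotv z (consv (a, w))].

Lemma measurable_cone : measurable cone.
Proof.
apply: measurableI; apply: measurable_set_ler => //; try exact: measurable_dotv.
by apply: measurable_funM => //; exact: measurable_normv.
Qed.

Let q2 : q ^+ 2 = 1 - delta ^+ 2.
Proof. by rewrite sqr_sqrtr// subr_ge0 exprn_ile1// ltW. Qed.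

Let q_gt0 : 0 < q.
Proof. by rewrite sqrtr_gt0 subr_gt0 exprn_ilt1// ltW. Qed.

(** Rates of the two exponential densities in [H]; dividing a density by its rate leaves the bare
    exponential on a half-line. *)
Let c1 := m%:R / delta.
Let c2 := m%:R * delta / q ^+ 2.

Let m0 : 0 < m%:R :> R. Proof. by rewrite ltr0n. Qed.

Let c1_gt0 : 0 < c1. Proof. exact: divr_gt0. Qed.

Let c2_gt0 : 0 < c2. Proof. by rewrite divr_gt0 ?mulr_gt0// exprn_gt0. Qed.

(* Dominates the volume of the slice at height s, relative to q^m kappa: it is
   exp (m (s - delta) / delta) below delta and exp (- m delta (s - delta) / q^2)
   above, and integrates to 1 / (m delta). *)
Let H (s : R) : R := c1^-1 * exponential_pdf c1 (-1 * s + delta) +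
  c2^-1 * exponential_pdf c2 (1 * s + - delta).

Let mH1 : measurable_fun setT (fun s : R => exponential_pdf c1 (-1 * s + delta)).
Proof.
apply: (@measurableT_comp _ _ _ _ _ _ (exponential_pdf c1)).
  exact: measurable_exponential_pdf.
exact: measurable_affine.
Qed.

Let mH2 : measurable_fun setT (fun s : R => exponential_pdf c2 (1 * s + - delta)).
Proof.
apply: (@measurableT_comp _ _ _ _ _ _ (exponential_pdf c2)).
  exact: measurable_exponential_pdf.
exact: measurable_affine.
Qed.

Let H_ge0 s : 0 <= H s.
Proof.
by rewrite addr_ge0// mulr_ge0 ?invr_ge0 ?exponential_pdf_ge0// ltW.
Qed.

Let mH : measurable_fun setT (EFin \o H).
Proof.
by apply/measurable_EFinP; apply: measurable_funD; exact: measurable_funM.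
Qed.

Let integral_pdf_affine (c e b : R) : 0 < c -> `|e| = 1 ->
  (\int[leb]_s (exponential_pdf c (e * s + b))%:E = 1)%E.
Proof.
move=> c0 e1.
have := @ge0_integral_affine R e b (fun s => (exponential_pdf c s)%:E).
rewrite integral_exponential_pdf// e1 mul1e => ->//.
- by rewrite -normr_eq0 e1 oner_eq0.
- by apply/measurable_EFinP; exact: measurable_exponential_pdf.
- by move=> x; rewrite lee_fin exponential_pdf_ge0// ltW.
Qed.

(** Each density has mass 1, so the integral is 1/c1 + 1/c2 = (delta^2 + q^2) / (m delta), and
    delta^2 + q^2 = 1. *)
Let integral_H : (\int[leb]_s (H s)%:E = (m%:R * delta)^-1%:E)%E.
Proof.
rewrite /H; under eq_integral do rewrite EFinD !EFinM.
rewrite ge0_integralD//=; last 4 first.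
- by move=> s _; rewrite mule_ge0// lee_fin ?invr_ge0 ?exponential_pdf_ge0// ltW.
- by apply/measurable_funeM; exact/measurable_EFinP.
- by move=> s _; rewrite mule_ge0// lee_fin ?invr_ge0 ?exponential_pdf_ge0// ltW.
- by apply/measurable_funeM; exact/measurable_EFinP.
rewrite !ge0_integralZl//; last 6 first.
- exact/measurable_EFinP.
- by move=> s _; rewrite lee_fin exponential_pdf_ge0// ltW.
- by rewrite lee_fin invr_ge0 ltW.
- exact/measurable_EFinP.
- by move=> s _; rewrite lee_fin exponential_pdf_ge0// ltW.
- by rewrite lee_fin invr_ge0 ltW.
rewrite !integral_pdf_affine ?normrN1 ?normr1// !mule1 -EFinD; congr EFin.
rewrite /c1 /c2 q2; field.
by rewrite -q2 !gt_eqF//= exprn_gt0.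
Qed.

(** The slice at height s lies in an ellipsoid whose squared radius is at most both (q s / delta)^2,
    from the cone, and 1 - s^2, from the ball. The two agree at s = delta; the cone is used below
    that height and the ball above it. For s < 0 the slice is empty. *)
Let cone_slice (s : R) :
  (@lebn R m [set x | cone (consv ((s - dotv x w) / a, x)%R)] <=
   (q ^+ m * H s)%:E * kappa)%E.
Proof.
(* It suffices to enclose the slice in the ellipsoid of radius q e for some e with e^m <= H s. *)
have key (e : R) : 0 < e -> e ^+ m <= H s ->
    (forall x, cone (consv ((s - dotv x w) / a, x)%R) ->
       slice_form a w (x - s *: w) <= (q * e) ^+ 2) ->
    (@lebn R m [set x | cone (consv ((s - dotv x w) / a, x)%R)] <=
      (q ^+ m * H s)%:E * kappa)%E.
  move=> e0 eH sub; have qe0 : 0 < q * e by rewrite mulr_gt0.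
  apply: (@le_trans _ _ (((q * e) ^+ m)%:E * kappa)%E).
    rewrite -(lebn_slice_form w a_neq0 (s *: w) qe0).
    apply: le_measure; rewrite ?inE; last exact: sub.
    - have := measurable_xsection s (measurable_oblique a w measurable_cone).
      congr measurable; apply/seteqP.
      by split => x; rewrite /xsection/= inE.
    - exact: measurable_slice_form.
  apply: lee_wpmul2r; first exact: slice_volume_ge0.
  by rewrite lee_fin exprMn ler_pM2l// exprn_gt0.
have cone_bounds x : cone (consv ((s - dotv x w) / a, x)%R) ->
    [/\ 0 <= s, s ^+ 2 + slice_form a w (x - s *: w) <= 1 &
        delta ^+ 2 * (s ^+ 2 + slice_form a w (x - s *: w)) <= s ^+ 2].
  rewrite /cone/= dotv_slice// -(dotvv_slice a_neq0 aw_unit) => -[z1 zs].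
  have dz0 : 0 <= delta * normv (consv ((s - dotv x w) / a, x)%R).
    by rewrite mulr_ge0 ?normv_ge0// ltW.
  have s0 := le_trans dz0 zs.
  split => //; rewrite -sqr_normv -exprMn.
  by rewrite ler_pXn2r// nnegrE.
have [sd|ds] := leP s delta.
- apply: (key (expR ((s - delta) / delta))); first exact: expR_gt0.
    rewrite /H exponential_pdfE; last by lra.
    rewrite mulKf ?gt_eqF// -expRM_natl.
    rewrite (_ : m%:R * _ = - c1 * (-1 * s + delta)); last by rewrite /c1; field; rewrite gt_eqF.
    by rewrite lerDl mulr_ge0 ?invr_ge0 ?exponential_pdf_ge0// ltW.
  move=> x /cone_bounds[s0 _ h].
  (* The comparison s / delta <= exp (s / delta - 1) is 1 + t <= exp t. *)
  apply: (@le_trans _ _ ((q * (s / delta)) ^+ 2)).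
    rewrite exprMn q2 expr_div_n mulrA ler_pdivlMr ?exprn_gt0//.
    lra.
  rewrite ler_pXn2r ?nnegrE ?mulr_ge0 ?expR_ge0 ?invr_ge0 ?(ltW q_gt0) ?(ltW delta_gt0)//.
  rewrite ler_pM2l//; apply: le_trans (expR_ge1Dx _).
  by rewrite mulrBl divff ?gt_eqF// addrC subrK.
- apply: (key (expR (- (delta * (s - delta) / q ^+ 2)))); first exact: expR_gt0.
    rewrite /H (@exponential_pdfE _ c2); last by lra.
    rewrite mulKf ?gt_eqF// -expRM_natl.
    rewrite (_ : m%:R * _ = - c2 * (1 * s + - delta)); last by rewrite /c2; field; rewrite gt_eqF.
    by rewrite lerDr mulr_ge0 ?invr_ge0 ?exponential_pdf_ge0// ltW.
  move=> x /cone_bounds[s0 h _].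
  rewrite exprMn -expRM_natl.
  (* For s > delta, 1 - s^2 = q^2 - (s - delta) (s + delta) <= q^2 - 2 delta (s - delta); then 1 + t
     <= exp t again. *)
  apply: (@le_trans _ _ (q ^+ 2 * (1 + 2 * - (delta * (s - delta) / q ^+ 2)))); last first.
    by rewrite ler_pM2l ?exprn_gt0//; exact: expR_ge1Dx.
  rewrite (_ : _ * (1 + _) = q ^+ 2 - 2 * (delta * (s - delta))); last by field; rewrite gt_eqF.
  by rewrite q2; nra.
Qed.

Lemma lebn_cone_le :
  (lebn cone <= (`|a^-1| * (q ^+ m / (m%:R * delta)))%:E * kappa)%E.
Proof.
rewrite (@lebn_oblique _ _ a w)//; last exact: measurable_cone.
rewrite EFinM -muleA; apply: lee_wpmul2l; first by rewrite lee_fin.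
apply: (@le_trans _ _ (\int[leb]_s ((q ^+ m)%:E * kappa * (H s)%:E))%E).
  apply: ge0_le_integral => //.
  - exact: (measurable_lebn_oblique a w measurable_cone).
  - exact: measurable_funeM.
  - by move=> s _; rewrite muleAC -EFinM; exact: cone_slice.
rewrite ge0_integralZl//; last 2 first.
- by move=> s _; rewrite lee_fin.
- by rewrite mule_ge0 ?slice_volume_ge0// lee_fin exprn_ge0// ltW.
by rewrite integral_H muleAC -EFinM.
Qed.

End cone_volume.

(** * Volumes of cubes and balls *)

Section ball_volume.
Context {R : realType}.
Local Notation leb := (@lebesgue_measure R).

Lemma unconsvK n : cancel (@unconsv R n) (@consv R n).
Proof.
move=> v; apply/rowP => i.
by case: (unliftP ord0 i) => [j|] ->; rewrite ?consvS ?consv0// mxE.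
Qed.

Lemma measurable_box n (r : R) :
  measurable [set v : 'rV[R]_n | forall i, `|v ord0 i| <= r].
Proof.
rewrite (_ : mkset _ = \bigcap_(i in [set: 'I_n]) [set v : 'rV[R]_n | `|v ord0 i| <= r]).
  apply: fin_bigcap_measurable => // i _; apply: measurable_set_ler => //.
  apply: (@measurableT_comp _ _ _ _ _ _ (fun x : R => `|x|)) => //.
  exact: measurable_coord.
by apply/seteqP; split => [v /= h i _|v /= h i]; exact: h.
Qed.

(** Cubes inside and around the unit ball show that its volume is positive and finite, which
    replaces computing it. *)
Lemma lebn_box n (r : R) : 0 <= r ->
  lebn [set v : 'rV[R]_n | forall i, `|v ord0 i| <= r] = ((2 * r) ^+ n)%:E.
Proof.
move=> r0; elim: n => [|n IHn].
  by rewrite /lebn expr0; case: asboolP => // -[] [].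
rewrite lebn_consE.
pose D : set (measurableTypeR R) := `[- r, r]%classic.
have mD : measurable D by exact: measurable_itv.
have DE : leb D = (2 * r)%:E.
  rewrite /D lebesgue_measure_itv/= lte_fin; have [rr|rr] := ltP (- r) r.
    by rewrite -EFinB; congr EFin; ring.
  by congr EFin; lra.
rewrite (eq_integral (fun x => ((2 * r) ^+ n)%:E * (\1_D x)%:E)%E); last first.
  move=> x _; rewrite indicE.
  have [xD|xD] := boolP (x \in D); last first.
    rewrite mule0 (_ : mkset _ = set0) ?measure0//.
    apply/seteqP; split => v //= /(_ ord0); rewrite consv0/= => xr.
    by move: xD; rewrite notin_setE; apply; rewrite /D/= in_itv/= -ler_norml.
  rewrite mule1 -IHn; congr lebn; apply/seteqP; split => v /= vr.
    by move=> i; have := vr (lift ord0 i); rewrite consvS.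
  move=> i; case: (unliftP ord0 i) => [j|] ->; rewrite ?consvS ?consv0//=.
  by move: xD; rewrite inE /D/= in_itv/= -ler_norml.
rewrite ge0_integralZl//; last 2 first.
- by apply/measurable_EFinP; exact: measurable_indic.
- by rewrite lee_fin exprn_ge0// mulr_ge0.
rewrite integral_indic// setIT.
by rewrite [X in (_ * X)%E]DE -EFinM exprSr.
Qed.

Lemma eball01 n : eball 0 1 = [set z : 'rV[R]_n | dotv z z <= 1].
Proof.
by apply/seteqP; split => z; rewrite /eball/= subr0 normv_le// expr1n.
Qed.

Lemma lebn_eball01_gt0 n : (0 < @lebn R n (eball 0 1))%E.
Proof.
(* In this cube |v|^2 <= n r^2 <= n r <= 1; taking n+1 keeps [r] positive in dimension 0. *)
pose r : R := n.+1%:R^-1.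
have r0 : 0 < r by rewrite invr_gt0 ltr0n.
have r1 : r <= 1 by rewrite invf_le1 ?ltr0n// ler1n.
apply: (@lt_le_trans _ _ (lebn [set v : 'rV[R]_n | forall i, `|v ord0 i| <= r])).
  by rewrite lebn_box ?lte_fin ?exprn_gt0 ?mulr_gt0// ltW.
apply: le_measure; rewrite ?inE.
- exact: measurable_box.
- exact: measurable_eball.
- rewrite eball01 => v /= vr.
  apply: (@le_trans _ _ (\sum_(i < n) r)).
    apply: ler_sum => i _; rewrite -expr2 -real_normK ?num_real//.
    rewrite expr2 -[leRHS]mulr1 ler_pM//; exact: le_trans (vr i) _.
  rewrite sumr_const card_ord -[_ *+ n]mulr_natl /r ler_pdivrMr ?ltr0n//.
  by rewrite mul1r ler_nat.
Qed.

Lemma lebn_eball01_fin n : @lebn R n (eball 0 1) \is a fin_num.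
Proof.
rewrite ge0_fin_numE; last exact: measure_ge0.
apply: (@le_lt_trans _ _ (lebn [set v : 'rV[R]_n | forall i, `|v ord0 i| <= 1])); last first.
  by rewrite lebn_box// ltry.
apply: le_measure; rewrite ?inE.
- exact: measurable_eball.
- exact: measurable_box.
- rewrite eball01 => v /= v1 i.
  rewrite -(@ler_pXn2r _ 2)// ?nnegrE// expr1n real_normK ?num_real//.
  apply: le_trans v1; rewrite /dotv (bigD1 i)//= -expr2 lerDl.
  by apply: sumr_ge0 => j _; rewrite -expr2 sqr_ge0.
Qed.

Lemma lebn_eball n (c : 'rV[R]_n) (r : R) : 0 < r ->
  lebn (eball c r) = ((r ^+ n)%:E * lebn (eball (0 : 'rV[R]_n) 1))%E.
Proof.
move=> r0; rewrite (@lebn_affine _ _ r c)//; last exact: measurable_eball.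
congr (_ * lebn _)%E; apply/seteqP; split => v /=;
by rewrite /eball/= addrK normvZ gtr0_norm// subr0 ger_pMr.
Qed.

End ball_volume.

(** * Fraction of a ball where a given point breaks separability *)

Section bad_set.
Context {R : realType} (m : nat) (delta : R).
Hypothesis m_ge4 : (4 <= m)%N.
Hypothesis delta_gt0 : 0 < delta.
Hypothesis delta_le : delta <= 1 / 2.
Local Notation q := (Num.sqrt (1 - delta ^+ 2)).
Local Notation p :=
  (2 / (delta * Num.sqrt m.+1%:R) * q ^+ m.+2).

(** Dividing the cone bound by the ball bound, what remains is 1/m <= (5/3) q^2 / (m+1). Since delta
    <= 1/2 gives q^2 >= 3/4, this follows from 5 m >= 4 (m+1), that is m >= 4. *)
Lemma lebn_cone_le_ball (a : R) (w : 'rV[R]_m) :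
  a != 0 -> a ^+ 2 + dotv w w = 1 ->
  (lebn (cone a w delta) <= p%:E * lebn (eball (0 : 'rV[R]_m.+1) 1))%E.
Proof.
move=> a0 aw1; have d1 : delta < 1 by move: delta_le; lra.
have m0 : 0 < m%:R :> R by rewrite ltr0n (leq_trans _ m_ge4).
have m4 : 4 <= m%:R :> R by rewrite (ler_nat R 4).
apply: (le_trans (@lebn_cone_le _ _ a w delta _ a0 aw1 delta_gt0 d1)).
  by rewrite (leq_trans _ m_ge4).
have sn0 : 0 < Num.sqrt m.+1%:R :> R by rewrite sqrtr_gt0 ltr0n.
have q2 : 3 / 4 <= q ^+ 2.
  have : delta ^+ 2 <= (1 / 2) ^+ 2.
    by rewrite ler_pXn2r ?nnegrE ?delta_le ?(ltW delta_gt0)//; lra.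
  by move=> ?; rewrite sqr_sqrtr; lra.
have q0 : 0 <= q ^+ m by rewrite exprn_ge0 ?sqrtr_ge0.
have p0 : 0 <= p.
  by rewrite mulr_ge0 ?exprn_ge0 ?sqrtr_ge0// divr_ge0// mulr_ge0// ltW.
apply: (@le_trans _ _ (p%:E *
    ((`|a^-1| * (5 / 6 / Num.sqrt m.+1%:R))%:E * slice_volume a w))%E); last first.
  apply: lee_wpmul2l; first by rewrite lee_fin.
  by rewrite eball01; exact: lebn_unit_ball_ge.
rewrite muleA -EFinM; apply: lee_wpmul2r; first exact: slice_volume_ge0.
rewrite lee_fin [leRHS]mulrCA ler_wpM2l//.
rewrite (_ : _ * (5 / 6 / _) = q ^+ m / delta * (5 / 3 * q ^+ 2 / m.+1%:R)); last first.
  have := @sqr_sqrtr R m.+1%:R (ler0n _ _).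
  move: (Num.sqrt m.+1%:R) sn0 => t t0 <-; rewrite !exprS.
  by field; rewrite !gt_eqF.
rewrite invfM mulrCA [leLHS]mulrC ler_wpM2l//; last first.
  by rewrite ler_pdivlMr ?ltr0n// mulrC ler_pdivrMr// -natr1; nra.
by rewrite divr_ge0// ltW.
Qed.

Lemma measurable_bad (y u : 'rV[R]_m.+1) (eps : R) :
  measurable [set x | [/\ normv (x - y) <= eps, 2 * delta < normv (x - y) &
    dotv (x - y) (x - y) <= dotv (x - y) u]].
Proof.
have mB : measurable_fun setT (fun x : 'rV[R]_m.+1 => x - y).
  exact: measurable_addv.
rewrite (_ : mkset _ = [set x | normv (x - y) <= eps] `&`
  [set x | 2 * delta < normv (x - y)] `&`
  [set x | dotv (x - y) (x - y) <= dotv (x - y) u]).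
  apply: measurableI; first apply: measurableI.
  - by apply: measurable_set_ler => //; exact: measurable_normv.
  - by apply: measurable_set_ltr => //; exact: measurable_normv.
  - by apply: measurable_set_ler; exact: measurable_dotv.
by apply/seteqP; split => x /= [[]].
Qed.

(** With z = x - y, the conditions give (z, u) >= |z|^2 >= 2 delta |z| >= delta |u| |z|, so z lies
    in a cone about u. Dilation by [eps] reduces to the unit ball. *)
Lemma lebn_bad_le (y u : 'rV[R]_m.+1) (eps : R) :
  0 < eps -> u ord0 ord0 != 0 -> normv u <= 2 ->
  (lebn [set x | [/\ (normv (x - y) <= eps)%R, (2 * delta < normv (x - y))%R &
                  (dotv (x - y) (x - y) <= dotv (x - y) u)%R]]
   <= p%:E * lebn (eball y eps))%E.
Proof.
move=> e0 u0 u2.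
have N0 : 0 < normv u.
  rewrite /normv sqrtr_gt0 /dotv big_ord_recl ltr_pwDl//.
    by rewrite -expr2 exprn_even_gt0.
  by apply: sumr_ge0 => i _; rewrite -expr2 sqr_ge0.
(* The axis must be a unit vector, with nonzero first coordinate [a] for the oblique coordinates to
   exist. *)
pose u' := (normv u)^-1 *: u.
pose a := u' ord0 ord0; pose w := (unconsv u').2.
have u'E : consv (a, w) = u' by rewrite -[RHS]unconsvK.
have a0 : a != 0 by rewrite /a mxE mulf_neq0// invr_eq0 gt_eqF.
have aw1 : a ^+ 2 + dotv w w = 1.
  rewrite expr2 -dotv_consv u'E dotvZl dotvZr -sqr_normv.
  by field; rewrite gt_eqF.
have mbad := measurable_bad y u eps.
rewrite (@lebn_affine _ _ eps y)// lebn_eball// muleCA.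
apply: lee_wpmul2l; first by rewrite lee_fin exprn_ge0// ltW.
apply: le_trans (lebn_cone_le_ball a0 aw1).
apply: le_measure; rewrite ?inE.
- exact: (measurable_preimage_affine eps y mbad).
- exact: measurable_cone.
- move=> v /=; rewrite addrK normvZ gtr0_norm// !(dotvZl, dotvZr) -sqr_normv.
  move=> [v1 v2 v3]; split.
    by rewrite -sqr_normv exprn_ile1 ?normv_ge0//; move: v1; rewrite ger_pMr.
  rewrite u'E dotvZr ler_pdivlMl//.
  move: v3; rewrite ler_pM2l// => v3.
  apply: le_trans v3.
  have : 0 <= normv v := normv_ge0 v.
  have : delta * normv u <= delta * 2 by rewrite ler_pM2l.
  move: v2; set N := normv v; set K := normv u => v2 dK N_0.
  rewrite mulrA (mulrC K) expr2 mulrA ler_wpM2r//.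
  by apply: le_trans dK _; rewrite mulrC ltW.
Qed.

End bad_set.

(** * Configurations as blocks of coordinates *)

Lemma index_allpairs (S T : eqType) (s : seq S) (t : seq T) x y :
  x \in s -> y \in t ->
  index (x, y) [seq (a, b) | a <- s, b <- t] = (index x s * size t + index y t)%N.
Proof.
move=> + yt; elim: s => //= a s IHs; rewrite in_cons index_cat size_map.
have [-> _|xa /= xs] := eqVneq x a.
  rewrite mem_map; last by move=> ? ? [].
  by rewrite yt index_map// => ? ? [].
rewrite ifN ?IHs ?mulSn ?addnA//.
by apply/negP => /mapP[b _ [/eqP]]; rewrite (negPf xa).
Qed.

Lemma val_enum_rank (T : finType) (x : T) : enum_rank x = index x (enum T) :> nat.
Proof.
rewrite -{2}(enum_rankK x) (enum_val_nth x) index_uniq ?enum_uniq//.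
by rewrite -cardE.
Qed.

(** The order is row-major, so each point of a configuration is a contiguous block of the flattened
    vector. *)
Lemma mxvec_indexE m n (i : 'I_m) (j : 'I_n) : mxvec_index i j = (i * n + j)%N :> nat.
Proof.
rewrite /= val_enum_rank enumT unlock /= /prod_enum index_allpairs ?mem_enum//.
by rewrite size_enum_ord !index_enum_ord.
Qed.

Section blocks.
Context {R : realType} (n : nat).

(** As [M.+1 * n] reduces to [n + M * n], [row_mx x v] is a configuration with first point [x]
    followed by the points of [v]. *)
Lemma row_vec_mx0 M (x : 'rV[R]_n) (v : 'rV[R]_(M * n)) :
  row ord0 (vec_mx (row_mx x v : 'rV[R]_(M.+1 * n))) = x.
Proof.
apply/rowP => j; rewrite !mxE; case: split_ordP => k /(congr1 val) /=.
  by rewrite -[LHS]/(nat_of_ord (mxvec_index _ _)) mxvec_indexE mul0n add0n => /val_inj ->.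
rewrite -[LHS]/(nat_of_ord (mxvec_index _ _)) mxvec_indexE mul0n add0n => jE.
by have := ltn_ord j; rewrite jE ltnNge leq_addr.
Qed.

Lemma row_vec_mxS M (x : 'rV[R]_n) (v : 'rV[R]_(M * n)) (i : 'I_M) :
  row (lift ord0 i) (vec_mx (row_mx x v : 'rV[R]_(M.+1 * n))) = row i (vec_mx v).
Proof.
apply/rowP => j; rewrite !mxE; case: split_ordP => k /(congr1 val) /=.
  rewrite -[LHS]/(nat_of_ord (mxvec_index _ _)) mxvec_indexE => kE.
  by have := ltn_ord k; rewrite -kE lift0 mulSn -addnA ltnNge leq_addr.
rewrite -[LHS]/(nat_of_ord (mxvec_index _ _)) mxvec_indexE lift0 mulSn -addnA.
move=> /addnI kE; congr (v _ _); apply: val_inj; rewrite /= -kE.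
by rewrite -[RHS]/(nat_of_ord (mxvec_index _ _)) mxvec_indexE.
Qed.

Lemma measurable_row_vec_mx M (i : 'I_M) :
  measurable_fun setT (fun v : 'rV[R]_(M * n) => row i (vec_mx v)).
Proof.
apply: measurable_fun_rV => j; under eq_fun do rewrite !mxE.
exact: measurable_coord.
Qed.

Lemma measurable_blocks M (B : 'I_M -> set 'rV[R]_n) (P : pred 'I_M) :
  (forall i, measurable (B i)) ->
  measurable [set v : 'rV[R]_(M * n) | forall i, P i -> B i (row i (vec_mx v))].
Proof.
move=> mB; rewrite (_ : mkset _ = \bigcap_(i in [set i | P i])
    (fun v => row i (vec_mx v)) @^-1` B i).
  apply: fin_bigcap_measurable => // i _.
  by rewrite -[X in measurable X]setTI; exact: measurable_row_vec_mx.
by apply/seteqP; split.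
Qed.

(** This is independence of the points. For a first point in its block the section is the product of
    the other blocks; otherwise it is empty. *)
Lemma lebn_blocks M (B : 'I_M -> set 'rV[R]_n) :
  (forall i, measurable (B i)) ->
  lebn [set v : 'rV[R]_(M * n) | forall i, B i (row i (vec_mx v))] =
  (\prod_i lebn (B i))%E.
Proof.
elim: M => [|M IHM] in B * => mB.
  rewrite big_ord0 -[lebn _]/(@lebn R 0 _) /lebn; case: asboolP => // -[] [].
  by [].
have mA := @measurable_blocks _ B xpredT mB.
rewrite (@lebn_cat _ n (M * n)); last first.
  have := mA; congr measurable; apply/seteqP.
  by split => v /= h i => [|_]; exact: h.
rewrite big_ord_recl.
rewrite (eq_integral (fun x => (\1_(B ord0) x)%:E *
    \prod_(i < M) lebn (B (lift ord0 i)))%E); last first.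
  move=> x _; rewrite indicE.
  have [xB|xB] := boolP (x \in B ord0); last first.
    rewrite mul0e (_ : mkset _ = set0) ?measure0//.
    apply/seteqP; split => v //= /(_ ord0); rewrite row_vec_mx0.
    by move: xB; rewrite notin_setE.
  rewrite mul1e -IHM//; congr lebn; apply/seteqP; split => v /= h.
    by move=> i; have := h (lift ord0 i); rewrite row_vec_mxS.
  move=> i; case: (unliftP ord0 i) => [j|] ->; first by rewrite row_vec_mxS.
  by rewrite row_vec_mx0; move: xB; rewrite inE.
rewrite ge0_integralZr//; last 2 first.
- by apply/measurable_EFinP; exact: measurable_indic.
- by apply: prode_ge0 => i _; exact: measure_ge0.
by rewrite integral_indic// setIT.
Qed.

(** Independence when two points are coupled by [G]. Leading points before [s] are split off one at
    a time; once [s] comes first, fixing its point turns the coupling into a constraint on point [t]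
    alone. *)
Lemma lebn_block_pair M (B : 'I_M -> set 'rV[R]_n) (s t : 'I_M)
    (G : set ('rV[R]_n * 'rV[R]_n)) :
  (s < t)%N -> (forall i, measurable (B i)) -> measurable G ->
  lebn [set v : 'rV[R]_(M * n) |
    (forall i, (i != s) && (i != t) -> B i (row i (vec_mx v))) /\
    G (row s (vec_mx v), row t (vec_mx v))] =
  (\prod_(i | (i != s) && (i != t)) lebn (B i) * (@lebn R n \x @lebn R n) G)%E.
Proof.
elim: M => [|M IHM] in B s t * => st mB mG; first by case: s st => [].
have mrow (i : 'I_M.+1) := @measurable_row_vec_mx M.+1 i.
rewrite (@lebn_cat _ n (M * n)); last first.
  apply: measurableI; first exact: (measurable_blocks _ mB).
  rewrite -[X in measurable X]setTI.
  by apply: (measurable_fun_pair (mrow s) (mrow t)).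
rewrite big_mkcond big_ord_recl.
case: (unliftP ord0 t) st => [t'|] -> st; last by [].
case: (unliftP ord0 s) st => [s'|] -> st.
- rewrite /= (_ : (\prod_(i < M) _)%E =
      (\prod_(i | (i != s') && (i != t')) lebn (B (lift ord0 i)))%E); last first.
    rewrite [RHS]big_mkcond; apply: eq_bigr => i _.
    by rewrite !(inj_eq lift_inj).
  rewrite (eq_integral (fun x => (\1_(B ord0) x)%:E *
     (\prod_(i | (i != s') && (i != t')) lebn (B (lift ord0 i)) *
      (@lebn R n \x @lebn R n) G))%E); last first.
    move=> x _; rewrite indicE.
    have [xB|xB] := boolP (x \in B ord0); last first.
      rewrite mul0e (_ : mkset _ = set0) ?measure0//.
      apply/seteqP; split => v //= -[/(_ ord0) + _]; rewrite row_vec_mx0.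
      by move: xB; rewrite notin_setE => xB /(_ isT).
    rewrite mul1e -(IHM (fun i => B (lift ord0 i)))//.
    congr lebn; apply/seteqP; split => v /=; rewrite !row_vec_mxS => -[h1 h2]; split => //.
      by move=> i ist; have := h1 (lift ord0 i); rewrite !(inj_eq lift_inj) row_vec_mxS; apply.
    move=> i; case: (unliftP ord0 i) => [j|] ->.
      by rewrite row_vec_mxS !(inj_eq lift_inj); exact: h1.
    by rewrite row_vec_mx0; move: xB; rewrite inE.
  rewrite ge0_integralZr//; last 2 first.
  + by apply/measurable_EFinP; exact: measurable_indic.
  + by rewrite mule_ge0//; apply: prode_ge0 => i _; exact: measure_ge0.
  by rewrite integral_indic// setIT muleA.
- rewrite /= mul1e (_ : (\prod_(i < M) _)%E =
      (\prod_(i | i != t') lebn (B (lift ord0 i)))%E); last first.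
    rewrite [RHS]big_mkcond; apply: eq_bigr => i _.
    by rewrite (inj_eq lift_inj).
  rewrite -ge0_integralZl//; last 2 first.
  + exact: measurable_fun_xsection.
  + by apply: prode_ge0 => i _; exact: measure_ge0.
  apply: eq_integral => x _ /=.
  (* With the first point fixed at [x], block [t'] becomes a section of [G], and the set is a plain
     product again. *)
  pose B' i := if i == t' then xsection G x else B (lift ord0 i).
  rewrite (_ : mkset _ = [set v : 'rV[R]_(M * n) | forall i, B' i (row i (vec_mx v))]); last first.
    apply/seteqP; split => v /=; rewrite row_vec_mx0 row_vec_mxS.
      move=> [h1 h2] i; rewrite /B'; case: eqVneq => [->|it].
        by rewrite /xsection/= inE.
      by have := h1 (lift ord0 i); rewrite row_vec_mxS (inj_eq lift_inj); apply.
    move=> h; split; last by have := h t'; rewrite /B' eqxx /xsection/= inE.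
    move=> i; case: (unliftP ord0 i) => [j|] -> //.
    rewrite row_vec_mxS (inj_eq lift_inj) /= => jt.
    by have := h j; rewrite /B' (negPf jt).
  rewrite lebn_blocks; last first.
    by move=> i; rewrite /B'; case: ifP => // _; exact: measurable_xsection.
  rewrite (bigD1 t')//= muleC; congr (_ * _)%E; last by rewrite /B' eqxx.
  by apply: eq_bigr => i it; rewrite /B' (negPf it).
Qed.

(** Transfers a bound on the probability of an event about two points to the whole configuration
    space. *)
Lemma lebn_block_pair_le M (B : 'I_M -> set 'rV[R]_n) (s t : 'I_M)
    (G : set ('rV[R]_n * 'rV[R]_n)) (p : R) :
  (s < t)%N -> (forall i, measurable (B i)) -> measurable G ->
  (G `<=` B s `*` B t) ->
  ((@lebn R n \x @lebn R n) G <= p%:E * (lebn (B s) * lebn (B t)))%E ->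
  (lebn ([set v : 'rV[R]_(M * n) | forall i, B i (row i (vec_mx v))] `&`
      [set v | G (row s (vec_mx v), row t (vec_mx v))]) <=
    p%:E * lebn [set v : 'rV[R]_(M * n) | forall i, B i (row i (vec_mx v))])%E.
Proof.
move=> st mB mG GB Gp.
rewrite (_ : _ `&` _ = [set v : 'rV[R]_(M * n) |
    (forall i, (i != s) && (i != t) -> B i (row i (vec_mx v))) /\
    G (row s (vec_mx v), row t (vec_mx v))]); last first.
  apply/seteqP; split => v /= [h1 h2]; split => //.
  have [/= hs ht] := GB _ h2.
  by move=> i; have [->//|si] := eqVneq i s; have [->//|ti] := eqVneq i t; apply: h1; rewrite si.
have ts : t != s by apply: contraTneq st => ->; rewrite ltnn.
rewrite lebn_block_pair// lebn_blocks//.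
rewrite [in leRHS](bigD1 s)//= [in leRHS](bigD1 t)//=.
rewrite !muleA [leRHS]muleC -(muleA p%:E).
by apply: lee_wpmul2l Gp; apply: prode_ge0 => i _; exact: measure_ge0.
Qed.

End blocks.

Arguments lebn : simpl never.

Lemma measure_bigsetU_le d (T : measurableType d) (R : realType)
    (mu : {measure set T -> \bar R}) (I : Type) (r : seq I) (A : I -> set T) :
  (forall i, measurable (A i)) ->
  (mu (\big[setU/set0]_(i <- r) A i) <= \sum_(i <- r) mu (A i))%E.
Proof.
move=> mA; elim: r => [|i r IHr]; first by rewrite !big_nil measure0.
rewrite !big_cons; apply: le_trans (measureU2 _ _ _) _ => //.
  exact: bigsetU_measurable.
exact: leeD2l.
Qed.

Lemma sume_const {R : realType} (I : finType) (x : R) (V : \bar R) :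
  V \is a fin_num ->
  (\sum_(i <- index_enum I) (x%:E * V) = (#|I|%:R * x)%:E * V)%E.
Proof.
move=> /fineK <-; rewrite -!EFinM sumEFin sumr_const; congr EFin.
by rewrite -mulrnAl mulr_natl.
Qed.

(** Expanding |b u - a v|^2 >= 0 gives 2 a b (u, v) <= b^2 |u|^2 + a^2 |v|^2 <= 2 a^2 b^2, hence (u,
    v) <= a b. *)
Lemma normvD_le {R : realType} n (u v : 'rV[R]_n) (a b : R) : 0 < a -> 0 < b ->
  normv u <= a -> normv v <= b -> normv (u + v) <= a + b.
Proof.
move=> a0 b0; have ab0 := addr_gt0 a0 b0.
rewrite (normv_le _ (ltW a0)) (normv_le _ (ltW b0)) (normv_le _ (ltW ab0)) => ua vb.
have := dotvv_ge0 (b *: u + (- a) *: v).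
rewrite !(dotvDl, dotvDr, dotvZl, dotvZr) (dotvC v u).
move: (dotv u u) (dotv v v) (dotv u v) ua vb => A B D Aa Bb h.
suff : D <= a * b by rewrite sqrrD; lra.
rewrite -(ler_pM2l (mulr_gt0 a0 b0)).
have : b ^+ 2 * A <= b ^+ 2 * a ^+ 2 by rewrite ler_pM2l// exprn_gt0.
have : a ^+ 2 * B <= a ^+ 2 * b ^+ 2 by rewrite ler_pM2l// exprn_gt0.
by lra.
Qed.

(** Makes negligible the positions of x_j for which u has first coordinate 0. *)
Lemma lebn_hyperplane {R : realType} m (c : R) :
  lebn [set v : 'rV[R]_m.+1 | v ord0 ord0 = c] = 0%E.
Proof.
rewrite lebnS /pushforward.
rewrite (_ : _ @^-1` _ = [set c] `*` [set: 'rV[R]_m]); last first.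
  by apply/seteqP; split => -[x v] /=; rewrite consv0//= => -[].
rewrite product_measure1E//.
by rewrite [X in (X * _)%E]lebesgue_measure_set1 mul0e.
Qed.

(** * The union bound *)

Section separation.
Context {R : realType} (m M : nat) (Y : 'M[R]_(M, m.+1)) (eps delta : R).
Hypothesis eps_gt0 : 0 < eps.
Hypothesis eps_lt1 : eps < 1.
Hypothesis Y_le : forall i, normv (row i Y) <= 1 - eps.
Hypothesis m_ge4 : (4 <= m)%N.
Hypothesis delta_gt0 : 0 < delta.
Hypothesis delta_lt : 2 * delta < eps.
Local Notation p :=
  (2 / (delta * Num.sqrt m.+1%:R) * Num.sqrt (1 - delta ^+ 2) ^+ m.+2).
Local Notation B i := (eball (row i Y) eps).
Local Notation S := (config_support Y eps).

Let mB i : measurable (B i). Proof. exact: measurable_eball. Qed.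

Let mS : measurable S.
Proof.
have := @measurable_blocks R m.+1 M (fun i => B i) xpredT mB.
by congr measurable; apply/seteqP; split => v /= h i => [|_]; exact: h.
Qed.

(** The pair [q] is (x_i, x_j). Points x_i within 2 delta of their centre are excluded here and
    counted separately. *)
Definition bad_pair (i j : 'I_M) : set ('rV[R]_m.+1 * 'rV[R]_m.+1) :=
  [set q | [/\ B i q.1, B j q.2, 2 * delta < normv (q.1 - row i Y) &
    dotv (q.1 - row i Y) (q.1 - row i Y) <= dotv (q.1 - row i Y) (q.2 - row i Y)]].

Lemma measurable_bad_pair i j : measurable (bad_pair i j).
Proof.
have m1 : measurable_fun setT (fun q : 'rV[R]_m.+1 * 'rV[R]_m.+1 => q.1 - row i Y).
  by apply: measurable_addv => //; exact: measurable_fst.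
have m2 : measurable_fun setT (fun q : 'rV[R]_m.+1 * 'rV[R]_m.+1 => q.2 - row i Y).
  by apply: measurable_addv => //; exact: measurable_snd.
rewrite (_ : bad_pair i j = (B i `*` B j) `&`
  ([set q | 2 * delta < normv (q.1 - row i Y)] `&`
   [set q | dotv (q.1 - row i Y) (q.1 - row i Y) <= dotv (q.1 - row i Y) (q.2 - row i Y)])).
  apply: measurableI; first exact: measurableX.
  apply: measurableI.
    by apply: measurable_set_ltr => //; exact: measurable_normv.
  by apply: measurable_set_ler; exact: measurable_dotv.
by apply/seteqP; split => q /=; [case=> *; do !split|case=> -[? ?] [? ?]; split].
Qed.

(** The point w = x_j is integrated last: for almost every fixed w, [lebn_bad_le] with u = w - y_i
    bounds the volume of the admissible x_i. *)
Lemma lebn_bad_pair_le i j :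
  (\int[@lebn R m.+1]_w lebn [set x | bad_pair i j (x, w)] <=
   p%:E * (lebn (B i) * lebn (B j)))%E.
Proof.
have p0 : 0 <= p.
  by rewrite mulr_ge0 ?exprn_ge0 ?sqrtr_ge0// divr_ge0// mulr_ge0 ?sqrtr_ge0// ltW.
have -> : (p%:E * (lebn (B i) * lebn (B j)) =
    \int[@lebn R m.+1]_w (p%:E * lebn (B i) * (\1_(B j) w)%:E))%E.
  rewrite ge0_integralZl//.
  - by rewrite integral_indic// setIT muleA.
  - by apply/measurable_EFinP; exact: measurable_indic.
  - by rewrite mule_ge0.
apply: ae_ge0_le_integral => //.
- have := measurable_fun_ysection (@lebn R m.+1) (measurable_bad_pair i j).
  congr measurable_fun; apply/funext => w; rewrite /comp; congr (lebn _).
  by apply/seteqP; split => x; rewrite /ysection/= inE.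
- by move=> w _; rewrite !mule_ge0.
- by apply: measurable_funeM; apply/measurable_EFinP; exact: measurable_indic.
exists [set w : 'rV[R]_m.+1 | w ord0 ord0 = row i Y ord0 ord0]; split.
- rewrite (_ : mkset _ = (fun w : 'rV[R]_m.+1 => w ord0 ord0 : R) @^-1` [set row i Y ord0 ord0])//.
  by rewrite -[X in measurable X]setTI; apply: measurable_coord.
- exact: lebn_hyperplane.
move=> w h; apply: contrapT => wY; apply: h => _.
rewrite indicE; have [wB|wB] := boolP (w \in B j); last first.
  rewrite mule0 (_ : mkset _ = set0) ?measure0//.
  apply/seteqP; split => x //= -[_ /= wB' _ _].
  by move: wB; rewrite notin_setE.
rewrite mule1.
apply: le_trans (@lebn_bad_le _ m delta m_ge4 delta_gt0 _ (row i Y) (w - row i Y) eps _ _ _).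
- apply: le_measure; rewrite ?inE.
  + have := measurable_ysection w (measurable_bad_pair i j).
    congr measurable; apply/seteqP.
    by split => x; rewrite /ysection/= inE.
  + exact: measurable_bad.
  + by move=> x [/= ? ? ? ?]; split.
- by move: delta_lt eps_lt1; lra.
- exact: eps_gt0.
- by rewrite !mxE subr_eq0; apply/eqP => wYE; apply: wY; rewrite mxE.
(* Here |u| <= |w - y_j| + |y_j| + |y_i| <= eps + 2 (1 - eps) <= 2. *)
- have e1 : 0 < 1 - eps by rewrite subr_gt0.
  have h1 : normv (row j Y - row i Y) <= (1 - eps) + (1 - eps).
    by apply: normvD_le => //; rewrite -scaleN1r normvZ normrN1 mul1r.
  rewrite -(subrK (row j Y) w) -addrA.
  apply: (@le_trans _ _ (eps + (1 - eps + (1 - eps)))).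
    apply: normvD_le => //; first exact: addr_gt0.
    by move: wB; rewrite inE.
  by move: eps_gt0; lra.
Qed.

(** The coupling lemma orders its two indices, whereas x_j must be integrated last. For i < j this
    takes an exchange of integrals; for j < i, swapping the components of the pair suffices. *)
Lemma lebn_support_bad_le i j : i != j ->
  (lebn (S `&` [set v | bad_pair i j (row i (vec_mx v), row j (vec_mx v))]) <=
   p%:E * lebn S)%E.
Proof.
move=> ij; have mG := measurable_bad_pair i j.
have [lt_ij|lt_ji|/val_inj/eqP] := ltngtP i j; last by rewrite (negPf ij).
- apply: (@lebn_block_pair_le _ _ _ (fun k => B k)) => //.
    by move=> q [].
  rewrite /product_measure1 /comp product_measure_swap//.
  rewrite (eq_integral (fun w => lebn [set x | bad_pair i j (x, w)])).
    exact: lebn_bad_pair_le.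
  move=> w _; congr (lebn _).
  by apply/seteqP; split => x; rewrite /ysection/= inE.
- pose G' := (fun q : 'rV[R]_m.+1 * 'rV[R]_m.+1 => (q.2, q.1)) @^-1` bad_pair i j.
  have mG' : measurable G'.
    by rewrite -[X in measurable X]setTI; exact: (measurable_swap _ mG).
  apply: (@lebn_block_pair_le _ _ _ (fun k => B k) j i G') => //.
    by move=> q [].
  rewrite /product_measure1 /comp [X in (_ * X)%E]muleC.
  rewrite (eq_integral (fun w => lebn [set x | bad_pair i j (x, w)])).
    exact: lebn_bad_pair_le.
  move=> w _; congr (lebn _).
  by apply/seteqP; split => x; rewrite /xsection/= inE.
Qed.

(** As 2 delta < eps, the event |x_i - y_i| <= 2 delta in the support is again a product of balls,
    with ball [i] shrunk. *)
Definition small_block (i k : 'I_M) : set 'rV[R]_m.+1 :=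
  if k == i then eball (row i Y) (2 * delta) else B k.

Let msmall i k : measurable (small_block i k).
Proof. by rewrite /small_block; case: ifP => // _; exact: measurable_eball. Qed.

Lemma lebn_small_block i :
  lebn [set v : 'rV[R]_(M * m.+1) | forall k, small_block i k (row k (vec_mx v))] =
  (((2 * delta / eps) ^+ m.+1)%:E * lebn S)%E.
Proof.
rewrite lebn_blocks// [X in _ = (_ * X)%E](@lebn_blocks R m.+1 M (fun k => B k))//.
rewrite [LHS](bigD1 i)//= [in RHS](bigD1 i)//= muleA; congr (_ * _)%E; last first.
  by apply: eq_bigr => k ki; rewrite /small_block (negPf ki).
have e0 : eps != 0 by rewrite gt_eqF.
rewrite /small_block eqxx lebn_eball ?mulr_gt0// (lebn_eball _ eps_gt0).
by rewrite muleA -EFinM -exprMn divfK.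
Qed.

Lemma lebn_config_gt0 : (0 < lebn S)%E.
Proof.
rewrite (@lebn_blocks R m.+1 M (fun k => B k))//.
rewrite (@big_ind _ (fun x : \bar R => (0 < x)%E))//.
  by move=> x y x0 y0; rewrite mule_gt0.
move=> i _; rewrite lebn_eball//.
by rewrite mule_gt0 ?lebn_eball01_gt0// lte_fin exprn_gt0.
Qed.

Lemma lebn_config_fin : lebn S \is a fin_num.
Proof.
rewrite (@lebn_blocks R m.+1 M (fun k => B k))//.
apply: (@big_ind _ (fun x : \bar R => x \is a fin_num)) => //.
  by move=> x y x0 y0; rewrite fin_numM.
by move=> i _; rewrite lebn_eball// fin_numM// lebn_eball01_fin.
Qed.

Let mFisher : measurable [set v | fisher_separable (vec_mx v) Y].
Proof.
pose A (q : 'I_M * 'I_M) := [set v : 'rV[R]_(M * m.+1) |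
  dotv (row q.1 (vec_mx v) - row q.1 Y) (row q.2 (vec_mx v) - row q.1 Y) <
  dotv (row q.1 (vec_mx v) - row q.1 Y) (row q.1 (vec_mx v) - row q.1 Y)].
rewrite (_ : mkset _ = \bigcap_(q in [set q | q.1 != q.2]) A q).
  apply: fin_bigcap_measurable => [|q _].
    exact: (finite_finpred [pred q : 'I_M * 'I_M | q.1 != q.2]).
  have mr k : measurable_fun setT (fun v : 'rV[R]_(M * m.+1) => row k (vec_mx v) - row q.1 Y).
    by apply: measurable_addv => //; exact: measurable_row_vec_mx.
  by apply: measurable_set_ltr; exact: measurable_dotv.
apply/seteqP; split => [v /= h [i j] ij|v /= h i j ij]; first exact: h.
exact: (h (i, j) ij).
Qed.

(** Empty on the diagonal, so that the union can run over all M^2 pairs. *)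
Let bad (q : 'I_M * 'I_M) : set 'rV[R]_(M * m.+1) := if q.1 == q.2 then set0 else
  S `&` [set v | bad_pair q.1 q.2 (row q.1 (vec_mx v), row q.2 (vec_mx v))].

Let small i := [set v : 'rV[R]_(M * m.+1) | forall k, small_block i k (row k (vec_mx v))].

Let config_cover : S `<=` (S `&` [set v | fisher_separable (vec_mx v) Y]) `|`
  (\big[setU/set0]_(i <- index_enum 'I_M) small i `|`
   \big[setU/set0]_(q <- index_enum ('I_M * 'I_M)%type) bad q).
Proof.
move=> v Sv; have [?|nF] := pselect (fisher_separable (vec_mx v) Y); first by left.
right; move: nF => /existsNP[i /existsNP[j /not_implyP[ij /negP]]].
rewrite -leNgt => h; rewrite -!bigcup_seq.
have [vi|vi] := leP (normv (row i (vec_mx v) - row i Y)) (2 * delta).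
  left; exists i; first by rewrite /= mem_index_enum.
  by move=> k; rewrite /small_block; case: eqVneq => [->|_]; [exact: vi|exact: Sv].
right; exists (i, j); first by rewrite /= mem_index_enum.
rewrite /bad /= (negPf ij); split => //; split => //=; exact: Sv.
Qed.

(** The union bound is first proved for volumes, then divided by the volume of the support, which is
    positive and finite. *)
Lemma prob_fisher_separable_ge :
  1 - M%:R ^+ 2 * p - M%:R * (2 * delta / eps) ^+ m.+1 <= prob_fisher_separable Y eps.
Proof.
pose F : set 'rV[R]_(M * m.+1) := [set v | fisher_separable (vec_mx v) Y].
have mSF : measurable (S `&` F) by exact: measurableI.
have msm i : measurable (small i).
  have := measurable_blocks xpredT (msmall i).
  by congr measurable; apply/seteqP; split => v /= h k => [|_]; exact: h.
have mrow (i : 'I_M) := @measurable_row_vec_mx R m.+1 M i.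
have mbad q : measurable (bad q).
  rewrite /bad; case: ifP => // _; apply: measurableI => //.
  rewrite -[X in measurable X]setTI.
  by apply: (measurable_fun_pair (mrow q.1) (mrow q.2)) => //; exact: measurable_bad_pair.
have p0 : 0 <= p.
  by rewrite mulr_ge0 ?exprn_ge0 ?sqrtr_ge0// divr_ge0// mulr_ge0 ?sqrtr_ge0// ltW.
have key : (lebn S <= lebn (S `&` F) +
    ((M%:R * (2 * delta / eps) ^+ m.+1)%:E * lebn S + (M%:R ^+ 2 * p)%:E * lebn S))%E.
  apply: (@le_trans _ _ (lebn ((S `&` F) `|`
      (\big[setU/set0]_(i <- index_enum 'I_M) small i `|`
       \big[setU/set0]_(q <- index_enum ('I_M * 'I_M)%type) bad q)))).
    apply: le_measure; rewrite ?inE//.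
    by do 2?apply: measurableU => //; exact: bigsetU_measurable.
  apply: le_trans (measureU2 _ _ _) _ => //.
    by apply: measurableU; exact: bigsetU_measurable.
  apply: leeD2l; apply: le_trans (measureU2 _ _ _) _; try exact: bigsetU_measurable.
  apply: leeD; apply: le_trans (measure_bigsetU_le _ _ _) _ => //.
    rewrite (eq_bigr (fun=> ((2 * delta / eps) ^+ m.+1)%:E * lebn S)%E); last first.
      by move=> i _; exact: lebn_small_block.
    by rewrite sume_const ?lebn_config_fin// card_ord.
  apply: (@le_trans _ _ (\sum_(q <- index_enum ('I_M * 'I_M)%type) p%:E * lebn S)%E).
    apply: lee_sum => q _; rewrite /bad; case: eqVneq => [_|qq].
      by rewrite measure0 mule_ge0.
    exact: lebn_support_bad_le.
  by rewrite sume_const ?lebn_config_fin// card_prod card_ord natrM expr2.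
have SFfin : lebn (S `&` F) \is a fin_num.
  rewrite ge0_fin_numE; last exact: measure_ge0.
  apply: (@le_lt_trans _ _ (lebn S)); last by rewrite ltey_eq lebn_config_fin.
  by apply: le_measure; rewrite ?inE//; exact: subIsetl.
rewrite /prob_fisher_separable -/F.
move: key (lebn_config_gt0); rewrite -(fineK lebn_config_fin) -(fineK SFfin).
rewrite -!EFinM -!EFinD lee_fin lte_fin.
move: (fine (lebn S)) (fine (lebn (S `&` F))) => V W VW V0.
rewrite ler_pdivlMr// !mulrBl mul1r.
by move: VW; move: (_ * p * V) (_ * _ ^+ m.+1 * V) => x y /=; lra.
Qed.

End separation.

(** * Degenerate cases and choice of the constants *)

Lemma prob_fisher_separable_ge0 {R : realType} M n (Y : 'M[R]_(M, n)) (eps : R) :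
  0 <= prob_fisher_separable Y eps.
Proof. by rewrite divr_ge0// fine_ge0. Qed.

(** For M = 0 the configuration space is the single point of R^0, of mass 1. This also settles small
    dimensions in the second claim. *)
Lemma prob_fisher_separable0 {R : realType} n (Y : 'M[R]_(0, n)) (eps : R) :
  prob_fisher_separable Y eps = 1.
Proof.
have lebT : lebn [set: 'rV[R]_(0 * n)] = 1%E.
  by rewrite -[lebn _]/(@lebn R 0 _) /lebn; case: asboolP => // -[].
have ST : config_support Y eps = setT by apply/seteqP; split => v //= _ [].
have FT : [set v | fisher_separable (vec_mx v) Y] = setT.
  by apply/seteqP; split => v //= _ [].
by rewrite /prob_fisher_separable FT ST setTI lebT /= divr1.
Qed.

Lemma prob_fisher_separable_bound {R : realType} (eps : R) :
  0 < eps -> eps < 1 ->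
  forall (n M : nat) (Y : 'M[R]_(M, n)) (delta : R),
     (0 < n)%N ->
     (forall i : 'I_M, normv (row i Y) <= 1 - eps) ->
     1 / Num.sqrt (n%:R) < delta -> delta < 1 ->
     1 - (2 * (M%:R) ^+ 2) / (delta * Num.sqrt (n%:R))
           * (Num.sqrt (1 - delta ^+ 2)) ^+ n.+1
       - M%:R * (2 * delta / eps) ^+ n
     <= prob_fisher_separable Y eps.
Proof.
move=> e0 e1 [//|m] M Y delta _ Ye dn d1.
have sn0 : 0 < Num.sqrt m.+1%:R :> R by rewrite sqrtr_gt0 ltr0n.
have d0 : 0 < delta by apply: lt_trans dn; rewrite div1r invr_gt0.
have [M0|M0] := posnP M.
  by subst M; rewrite expr0n mulr0 !mul0r !subr0 prob_fisher_separable0.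
have M1 : 1 <= M%:R :> R by rewrite ler1n.
(* If eps <= 2 delta, the last subtracted term is at least M >= 1 and the bound is nonpositive. *)
have [ed|de] := leP eps (2 * delta).
  apply: le_trans (prob_fisher_separable_ge0 Y eps).
  have : 1 <= (2 * delta / eps) ^+ m.+1.
    by rewrite exprn_ege1// ler_pdivlMr// mul1r.
  have : 0 <= 2 * M%:R ^+ 2 / (delta * Num.sqrt m.+1%:R) * Num.sqrt (1 - delta ^+ 2) ^+ m.+2.
    by rewrite mulr_ge0 ?exprn_ge0 ?sqrtr_ge0// divr_ge0 ?mulr_ge0 ?exprn_ge0// ltW.
  move: (_ ^+ m.+1) => x P0 x1; nra.
(* From 2 delta < eps < 1 and 1 / sqrt n < delta one gets sqrt n > 2, so n = m+1 > 4. *)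
have m4 : (4 <= m)%N.
  have : 4 < m.+1%:R :> R.
    rewrite -(@sqr_sqrtr _ m.+1%:R)//.
    have s2 : 2 < Num.sqrt m.+1%:R :> R.
      move: dn; rewrite ltr_pdivrMr// => h.
      have : delta * Num.sqrt m.+1%:R < 1 / 2 * Num.sqrt m.+1%:R.
        by rewrite ltr_pM2r//; lra.
      by lra.
    by rewrite (_ : 4 = 2 ^+ 2); [rewrite ltr_pXn2r ?nnegrE ?ltW|ring].
  by rewrite (ltr_nat R 4).
apply: le_trans (prob_fisher_separable_ge e0 e1 Ye m4 d0 de).
rewrite le_eqVlt; apply/orP; left; apply/eqP; congr (1 - _ - _).
by rewrite [RHS]mulrA; congr (_ * _); rewrite [RHS]mulrCA mulrA.
Qed.

Theorem theorem6 (R : realType) (eps : R) (heps0 : 0 < eps) (heps1 : eps < 1) :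
  (forall (n M : nat) (Y : 'M[R]_(M, n)) (delta : R),
     (0 < n)%N ->
     (forall i : 'I_M, normv (row i Y) <= 1 - eps) ->
     1 / Num.sqrt (n%:R) < delta -> delta < 1 ->
     1 - (2 * (M%:R) ^+ 2) / (delta * Num.sqrt (n%:R))
           * (Num.sqrt (1 - delta ^+ 2)) ^+ n.+1
       - M%:R * (2 * delta / eps) ^+ n
     <= prob_fisher_separable Y eps)
  /\
  (forall v : R, 0 < v ->
     exists a b : R, 0 < a /\ 1 < b /\
       forall (n M : nat) (Y : 'M[R]_(M, n)),
         (0 < n)%N ->
         (forall i : 'I_M, normv (row i Y) <= 1 - eps) ->
         M%:R < a * b ^+ n ->
         1 - v <= prob_fisher_separable Y eps).
Proof.
split; first exact: prob_fisher_separable_bound.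
(* With this choice 2 delta / eps = 1/2, and q < 1 depends on [eps] only. *)
move=> v v0; pose delta := eps / 4.
have d0 : 0 < delta by rewrite divr_gt0.
have d14 : delta < 1 / 4 by rewrite /delta; lra.
pose q := Num.sqrt (1 - delta ^+ 2).
have d2 : delta ^+ 2 < 1 / 16.
  rewrite (_ : 1 / 16 = (1 / 4) ^+ 2); last by field.
  by rewrite ltr_pXn2r ?nnegrE ?(ltW d0)//; lra.
have d2_0 : 0 < delta ^+ 2 by rewrite exprn_gt0.
have q2 : q ^+ 2 = 1 - delta ^+ 2 by rewrite sqr_sqrtr//; lra.
have q0 : 0 < q by rewrite sqrtr_gt0; lra.
have q1 : q < 1.
  by rewrite -(@ltr_pXn2r _ 2)// ?nnegrE ?(ltW q0)// q2 expr1n; lra.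
have q14 : 1 / 4 <= q.
  rewrite leNgt; apply/negP => ql.
  have : q ^+ 2 < (1 / 4) ^+ 2 by rewrite ltr_pXn2r ?nnegrE ?(ltW q0)//; lra.
  by rewrite q2; lra.
(* Chosen so that b^(2n) q^n = 1, which balances M^2 against the cone term; q >= 1/4 gives b <= 2,
   which balances M against 2^(-n). *)
pose b := (Num.sqrt q)^-1.
have sq0 : 0 < Num.sqrt q by rewrite sqrtr_gt0.
have b0 : 0 < b by rewrite invr_gt0.
have bb : b ^+ 2 = q^-1 by rewrite exprVn sqr_sqrtr// ltW.
have b1 : 1 < b.
  by rewrite -(@ltr_pXn2r _ 2)// ?nnegrE ?(ltW b0)// expr1n bb invf_gt1.
have b2 : b <= 2.
  rewrite -(@ler_pXn2r _ 2)// ?nnegrE ?(ltW b0)// bb.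
  by rewrite -[q^-1]mul1r ler_pdivrMr//; lra.
(* For n > N, delta^2 n > 1, so the first claim applies. *)
pose N := Num.bound (delta ^+ 2)^-1.
have bN0 : 0 < b ^- N by rewrite invr_gt0 exprn_gt0.
(* The bound 1 gives a^2 <= a, v/3 makes the total loss 2 a + a at most v, and b^(-N) forces M < 1
   when n <= N. *)
pose a := Num.min (Num.min 1 (v / 3)) (b ^- N).
have v30 : 0 < v / 3 by rewrite divr_gt0.
have a0 : 0 < a by rewrite !lt_min ltr01 v30 bN0.
have a1 : a <= 1 by rewrite !ge_min lexx.
have av : a <= v / 3 by rewrite !ge_min lexx orbT.
have aN : a <= b ^- N by rewrite ge_min lexx orbT.
exists a, b; split => //; split => // n M Y n0 Ye Mab.
have [nN|Nn] := leqP n N.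
  have M0 : M = 0%N.
    apply/eqP; rewrite -leqn0 -ltnS -(ltr_nat R).
    apply: (lt_le_trans Mab); apply: (@le_trans _ _ (b ^- N * b ^+ N)).
      by rewrite ler_pM ?(ltW a0) ?exprn_ge0 ?(ltW b0)// ler_weXn2l// ltW.
    by rewrite mulVf// gt_eqF// exprn_gt0.
  by subst M; rewrite prob_fisher_separable0; lra.
have sn0 : 0 < Num.sqrt n%:R :> R by rewrite sqrtr_gt0 ltr0n.
have dsn : 1 < delta * Num.sqrt n%:R.
  rewrite -(@ltr_pXn2r _ 2)// ?nnegrE ?(mulr_ge0 (ltW d0) (ltW sn0))//.
  rewrite expr1n exprMn sqr_sqrtr// -ltr_pdivrMl// mulr1.
  apply: (lt_trans (archi_boundP _)); first by rewrite invr_ge0 ltW.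
  by rewrite ltr_nat.
have dn : 1 / Num.sqrt n%:R < delta by rewrite ltr_pdivrMr//.
have d1 : delta < 1 by lra.
apply: le_trans (prob_fisher_separable_bound heps0 heps1 n0 Ye dn d1).
have M_ge0 : 0 <= M%:R :> R by [].
(* M^2 q^(n+1) <= a^2 q <= a, and the denominator delta sqrt n exceeds 1. *)
have l1 : 2 * M%:R ^+ 2 / (delta * Num.sqrt n%:R) * q ^+ n.+1 <= 2 * a.
  have : M%:R ^+ 2 <= a ^+ 2 * (q ^+ n)^-1.
    apply: (@le_trans _ _ ((a * b ^+ n) ^+ 2)).
      by rewrite ler_pXn2r ?nnegrE ?mulr_ge0 ?exprn_ge0 ?(ltW a0) ?(ltW b0)// ltW.
    by rewrite exprMn exprAC bb exprVn.
  rewrite ler_pdivlMr ?exprn_gt0// => Mq.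
  have h : M%:R ^+ 2 * q ^+ n.+1 <= a.
    rewrite (exprSr q) mulrA; apply: (@le_trans _ _ (a ^+ 2 * 1)).
      by rewrite ler_pM ?mulr_ge0 ?exprn_ge0 ?(ltW q0)// ltW.
    by rewrite mulr1 expr2 ger_pMr.
  have h0 : 0 <= M%:R ^+ 2 * q ^+ n.+1 by rewrite mulr_ge0 ?exprn_ge0 ?(ltW q0).
  rewrite mulrAC ler_pdivrMr ?(lt_trans _ dsn)// -mulrA.
  apply: (@le_trans _ _ (2 * a * 1)); first by lra.
  by rewrite ler_pM2l ?ltW// mulr_gt0.
have l2 : M%:R * (2 * delta / eps) ^+ n <= a.
  rewrite (_ : 2 * delta / eps = 2^-1); last by rewrite /delta; field; rewrite gt_eqF.
  apply: (@le_trans _ _ (a * b ^+ n * 2^-1 ^+ n)).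
    by rewrite ler_wpM2r ?exprn_ge0// ltW.
  rewrite -mulrA -exprMn ger_pMr// exprn_ile1 ?divr_ge0 ?(ltW b0)//.
  by rewrite ler_pdivrMr// mul1r.
by lra.
Qed.
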